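(* Let $A=(a_{ij})$ be a $d\times n$ integer matrix whose columns span $\mathbb{Z}^d$ (it is not assumed that $(1,\ldots,1)$ lies in the row space of $A$), and let $\beta\in\mathbb{C}^d$. Then $$\mathrm{rank}(H_A(\beta))\ \ge\ \mathrm{vol}(A).$$
   Context: The $\mathcal{A}$-hypergeometric (GKZ) ideal $H_A(\beta)$ is the left ideal of the Weyl algebra $\mathbb{C}\langle x_1,\ldots,x_n,\partial_1,\ldots,\partial_n\rangle$ generated by $\sum_{j=1}^n a_{ij}x_j\partial_j-\beta_i$ for $i=1,\ldots,d$ and all $\prod_{i=1}^n\partial_i^{u_i}-\prod_{j=1}^n\partial_j^{v_j}$ with $u,v\in\mathbb{N}^n$ ($\mathbb{N}=\{0,1,2,\ldots\}$) and $Au=Av$. $\mathrm{rank}(H_A(\beta))$ denotes the holonomic rank, i.e. the dimension over $\mathbb{C}(x)=\mathbb{C}(x_1,\ldots,x_n)$ of $R/R\,H_A(\beta)$, where $R=\mathbb{C}(x)\langle\partial_1,\ldots,\partial_n\rangle$. $\mathrm{vol}(A)$ denotes the normalized volume of $A$: $d!$ times the Euclidean volume in $\mathbb{R}^d$ of the convex hull of the origin and the columns $a_1,\ldots,a_n$ of $A$. *)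

(* Defs.v *)
From HB Require Import structures.
From mathcomp Require Import all_boot all_order all_algebra fraction ring.
From mathcomp Require Import complex.
(* The notations of mpoly clash with those of the analysis library, so they are
   filtered out: mpoly n K is {mpoly K[n]}, multinom n is the type of exponents,
   mpolyX K u the monomial of exponent u, mnm1 i the i-th unit exponent and
   mcoeff u P the coefficient of P at u. *)
From mathcomp Require mpoly.
From mathcomp Require Import all_classical all_reals all_analysis.
Import -(notations) mpoly.

Set Implicit Arguments.
Unset Strict Implicit.
Unset Printing Implicit Defensive.

Import Order.TTheory GRing.Theory Num.Theory.

Local Open Scope classical_set_scope.
Local Open Scope ring_scope.

Record derivations (n : nat) (K : comNzRingType) := Derivations {
  der :> 'I_n -> {additive K -> K};
  derM : forall i x y, der i (x * y) = der i x * y + x * der i y;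
  derC : forall i j x, der i (der j x) = der j (der i x) }.

(* K<d_1,..,d_n>, with d_i f = f d_i + D_i(f), in normal form: as a left
   K-module it is free on the monomials d_1^u_1 ... d_n^u_n, represented by those
   of mpoly n K, but it does not inherit the commutative product of mpoly n K. *)
Definition diffop (n : nat) (K : comNzRingType) (D : derivations n K) : Type :=
  mpoly n K.

Section DiffOp.
Variables (n : nat) (K : comNzRingType) (D : derivations n K).
Local Notation diffop := (diffop D).

HB.instance Definition _ := GRing.Lmodule.on diffop.

Implicit Types (P Q S : diffop) (u : multinom n).

Definition dmon u : diffop := mpolyX K u.

(* Left multiplication by d_i:
   d_i (sum_u c_u d^u) = sum_u (c_u d_i + D_i(c_u)) d^u. *)
Definition pdmul (i : 'I_n) Q : diffop :=
  (mpolyX K (mnm1 i) : mpoly n K) * Q + map_mpoly (D i) Q.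

Definition pdmulm (u : multinom n) Q : diffop :=
  foldr (fun i => iter (u i) (pdmul i)) Q (enum 'I_n).

Definition dmul P Q : diffop := \sum_(u <- msupp P) mcoeff u P *: pdmulm u Q.

Lemma pdmulD i : {morph pdmul i : P Q / P + Q}.
Proof. by move=> P Q; rewrite /pdmul mulrDr raddfD addrACA. Qed.

Lemma pdmul0 i : pdmul i 0 = 0.
Proof. by rewrite /pdmul mulr0 raddf0 addr0. Qed.

Lemma pdmulZ i c Q : pdmul i (c *: Q) = D i c *: Q + c *: pdmul i Q.
Proof.
rewrite /pdmul scalerDr scalerAr addrCA; congr (_ + _).
apply/mpolyP => m; rewrite mcoeff_map_mpoly mcoeffZ.
by rewrite [RHS]mcoeffD !mcoeffZ mcoeff_map_mpoly derM.
Qed.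

Lemma der1 i : D i 1 = 0.
Proof.
have := derM D i 1 1; rewrite !mulr1 mul1r => /eqP.
by rewrite -subr_eq subrr => /eqP.
Qed.

Lemma pdmulX i u : pdmul i (dmon u) = dmon (mnm_add u (mnm1 i)).
Proof.
rewrite /pdmul /dmon -mpolyXD addmC [X in _ + X](_ : _ = 0) ?addr0 //.
apply/mpolyP => m; rewrite mcoeff_map_mpoly mcoeffX mcoeff0.
by case: eqP => _; rewrite ?der1 ?raddf0.
Qed.

Lemma diffop_ind (T : diffop -> Prop) : T 0 ->
  (forall P Q, T P -> T Q -> T (P + Q)) ->
  (forall c u, T (c *: dmon u)) -> forall P, T P.
Proof.
move=> T0 TD TX P; rewrite [P]mpolyE.
by apply: (big_ind T) => // u _; apply: TX.
Qed.

Lemma pdmulC i j Q : pdmul i (pdmul j Q) = pdmul j (pdmul i Q).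
Proof.
elim/diffop_ind: Q => [|P Q hP hQ|c u].
- by rewrite !pdmul0.
- by rewrite ![pdmul _ (P + Q)]pdmulD 2!pdmulD hP hQ.
rewrite ![pdmul _ (c *: _)]pdmulZ 2!pdmulD !pdmulZ !pdmulX derC.
rewrite -!addmA [mnm_add (mnm1 j) _]addmC !addrA.
by rewrite -[X in X + _]addrA [X in _ + X + _]addrC addrA.
Qed.

Lemma iter_pdmulC i j k l Q :
  iter k (pdmul i) (iter l (pdmul j) Q) = iter l (pdmul j) (iter k (pdmul i) Q).
Proof.
elim: k => //= k ->; elim: l (iter k _ Q) => //= l IH P.
by rewrite pdmulC IH.
Qed.

Lemma pdmulm0 Q : pdmulm mnm0 Q = Q.
Proof. by rewrite /pdmulm; elim: (enum _) => //= i s ->; rewrite mnm0E. Qed.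

Lemma pdmulmS i u Q : pdmulm (mnm_add u (mnm1 i)) Q = pdmul i (pdmulm u Q).
Proof.
rewrite /pdmulm; have : uniq (enum 'I_n) by exact: enum_uniq.
have : i \in enum 'I_n by rewrite mem_enum.
elim: (enum _) => //= j s IH; rewrite inE => + /andP[js us].
have [eij _|ij /= si] := eqVneq i j; first subst j.
  rewrite mnmDE mnm1E eqxx addn1 /=; congr (pdmul _ (iter _ _ _)).
  move: js; elim: {IH us}s => //= k s IH; rewrite inE negb_or => /andP[ik si].
  by rewrite mnmDE mnm1E (negPf ik) addn0 IH.
rewrite mnmDE mnm1E (negPf ij) addn0 IH //.
by rewrite -[pdmul i _]/(iter 1 (pdmul i) _) iter_pdmulC.
Qed.

Lemma mnm_indU (T : multinom n -> Prop) : T mnm0 ->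
  (forall u i, T u -> T (mnm_add u (mnm1 i))) -> forall u, T u.
Proof.
move=> T0 TS u; have [k] := ubnP (mdeg u); elim: k u => // k IH u.
have [->//|u0 uk] := eqVneq u mnm0.
have [i ui] : exists i, u i != 0%N.
  apply/existsP; apply: contraNT u0; rewrite negb_exists => /forallP u0.
  by apply/eqP/mnmP => i; rewrite mnm0E; apply/eqP; rewrite -[_ == _]negbK.
have le1 : lem (mnm1 i) u by rewrite lep1mP.
rewrite -(submK le1); apply: TS; apply: IH.
by move: uk; rewrite -{1}(submK le1) mdegD mdeg1 addn1 ltnS.
Qed.

Lemma pdmulmD u : {morph pdmulm u : P Q / P + Q}.
Proof.
move=> P Q; elim/mnm_indU: u => [|u i IH]; rewrite ?pdmulm0 //.
by rewrite !pdmulmS IH pdmulD.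
Qed.

Lemma pdmulmX0 u : pdmulm u (dmon mnm0) = dmon u.
Proof.
elim/mnm_indU: u => [|u i IH]; first by rewrite pdmulm0.
by rewrite pdmulmS IH pdmulX.
Qed.

Lemma dmulEw P Q (s : seq (multinom n)) : uniq s -> {subset msupp P <= s} ->
  dmul P Q = \sum_(u <- s) mcoeff u P *: pdmulm u Q.
Proof.
move=> us sub; rewrite /dmul.
rewrite [RHS](bigID (fun u => u \in msupp P)) /= [X in _ + X]big1 ?addr0.
  rewrite -[RHS]big_filter; apply: perm_big.
  apply: (uniq_perm (msupp_uniq P) (filter_uniq _ us)) => u.
  by rewrite mem_filter; case: (boolP (u \in msupp P)) => //= /sub.
by move=> u /memN_msupp_eq0 ->; rewrite scale0r.
Qed.

Lemma dmulDl P1 P2 Q : dmul (P1 + P2) Q = dmul P1 Q + dmul P2 Q.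
Proof.
pose s := undup (msupp P1 ++ msupp P2 ++ msupp (P1 + P2)).
have us : uniq s by exact: undup_uniq.
rewrite !(@dmulEw _ Q s us); first last.
- by move=> u; rewrite mem_undup !mem_cat => ->; rewrite !orbT.
- by move=> u; rewrite mem_undup !mem_cat => ->; rewrite ?orbT.
- by move=> u; rewrite mem_undup !mem_cat => ->; rewrite ?orbT.
by rewrite -big_split; apply: eq_bigr => u _; rewrite /= -scalerDl -mcoeffD.
Qed.

Lemma dmulZl c P Q : dmul (c *: P) Q = c *: dmul P Q.
Proof.
pose s := undup (msupp P ++ msupp (c *: P)).
have us : uniq s by exact: undup_uniq.
rewrite !(@dmulEw _ Q s us); first last.
- by move=> u; rewrite mem_undup !mem_cat => ->; rewrite ?orbT.
- by move=> u; rewrite mem_undup !mem_cat => ->; rewrite ?orbT.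
by rewrite scaler_sumr; apply: eq_bigr => u _; rewrite /= mcoeffZ scalerA.
Qed.

Lemma dmul0l Q : dmul 0 Q = 0.
Proof. by rewrite /dmul msupp0 big_nil. Qed.

Lemma dmulDr P Q1 Q2 : dmul P (Q1 + Q2) = dmul P Q1 + dmul P Q2.
Proof.
rewrite /dmul -big_split; apply: eq_bigr => u _.
by rewrite /= pdmulmD scalerDr.
Qed.

Lemma dmulXl u Q : dmul (dmon u) Q = pdmulm u Q.
Proof. by rewrite /dmul /dmon msuppX big_seq1 mcoeffX eqxx scale1r. Qed.

Lemma dmul_pdmul i Q S : dmul (pdmul i Q) S = pdmul i (dmul Q S).
Proof.
elim/diffop_ind: Q => [|P Q hP hQ|c u].
- by rewrite pdmul0 !dmul0l pdmul0.
- by rewrite [pdmul i (P + Q)]pdmulD 2!dmulDl hP hQ pdmulD.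
by rewrite [pdmul i (c *: _)]pdmulZ pdmulX dmulDl !dmulZl !dmulXl pdmulmS pdmulZ.
Qed.

Lemma dmul_pdmulm u Q S : dmul (pdmulm u Q) S = pdmulm u (dmul Q S).
Proof.
elim/mnm_indU: u => [|u i IH]; rewrite ?pdmulm0 //.
by rewrite !pdmulmS dmul_pdmul IH.
Qed.

Lemma dmulA : associative dmul.
Proof.
move=> P Q S; elim/diffop_ind: P => [|P P' hP hP'|c u].
- by rewrite !dmul0l.
- by rewrite !dmulDl hP hP'.
by rewrite !dmulZl !dmulXl dmul_pdmulm.
Qed.

Definition dmul_one : diffop := dmon mnm0.

Lemma dmul1l : left_id dmul_one dmul.
Proof. by move=> Q; rewrite /dmul_one dmulXl pdmulm0. Qed.

Lemma dmul1r : right_id dmul_one dmul.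
Proof.
move=> P; rewrite [RHS]mpolyE /dmul; apply: eq_bigr => u _.
by rewrite pdmulmX0.
Qed.

Lemma dmul1_neq0 : dmul_one != 0.
Proof. rewrite /dmul_one /dmon mpolyX0; exact: (oner_neq0 (mpoly n K)). Qed.

HB.instance Definition _ := GRing.Zmodule_isNzRing.Build diffop
  dmulA dmul1l dmul1r dmulDl dmulDr dmul1_neq0.

Definition dcoef (f : K) : diffop := mpolyC n f.
Definition dpartial (i : 'I_n) : diffop := dmon (mnm1 i).

Lemma dpartialE i P : dpartial i * P = pdmul i P.
Proof.
by rewrite [LHS]dmulXl -{1}[mnm1 i]add0m // pdmulmS pdmulm0.
Qed.

Lemma dcoefZ f : dcoef f = f *: dmul_one.
Proof.
have := mul_mpolyC f (1 : mpoly n K).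
by rewrite mulr1 /dmul_one /dmon mpolyX0.
Qed.

Lemma dcoefE f P : dcoef f * P = f *: P.
Proof. by rewrite dcoefZ [LHS]dmulZl dmul1l. Qed.

Lemma dpartial_coef i f :
  dpartial i * dcoef f = dcoef f * dpartial i + dcoef (D i f).
Proof.
rewrite dpartialE dcoefE !dcoefZ pdmulZ pdmulX add0m.
by rewrite addrC.
Qed.

Lemma dpartialC i j : dpartial i * dpartial j = dpartial j * dpartial i.
Proof. by rewrite !dpartialE !pdmulX addmC. Qed.

End DiffOp.

Section MapDiffOp.
Variables (n : nat) (K L : comNzRingType).
Variables (D : derivations n K) (E : derivations n L) (f : {rmorphism K -> L}).
Hypothesis fD : forall i x, f (D i x) = E i (f x).

Definition map_diffop (P : diffop D) : diffop E := map_mpoly f P.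

Lemma map_diffopD P Q : map_diffop (P + Q) = map_diffop P + map_diffop Q.
Proof. exact: raddfD. Qed.

Lemma map_diffopZ c P : map_diffop (c *: P) = f c *: map_diffop P.
Proof. exact: map_mpolyZ. Qed.

Lemma map_diffop_mon u : map_diffop (dmon D u) = dmon E u.
Proof. exact: map_mpolyX. Qed.

Lemma map_diffop_pdmul i P : map_diffop (pdmul i P) = pdmul i (map_diffop P).
Proof.
elim/diffop_ind: P => [|P P' hP hP'|c u].
- by rewrite pdmul0 /map_diffop raddf0 pdmul0.
- by rewrite [pdmul i (P + P')]pdmulD 2!map_diffopD hP hP' pdmulD.
rewrite [pdmul i (c *: _)]pdmulZ pdmulX map_diffopD !map_diffopZ !map_diffop_mon.
by rewrite pdmulZ pdmulX fD.
Qed.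

Lemma map_diffopM P Q : map_diffop (P * Q) = map_diffop P * map_diffop Q.
Proof.
elim/diffop_ind: P => [|P P' hP hP'|c u].
- by rewrite mul0r /map_diffop raddf0 mul0r.
- by rewrite mulrDl !map_diffopD mulrDl hP hP'.
rewrite [_ * Q]dmulZl dmulXl !map_diffopZ [RHS]dmulZl map_diffop_mon dmulXl.
congr (_ *: _); elim/mnm_indU: u => [|u i IH]; first by rewrite !pdmulm0.
by rewrite !pdmulmS map_diffop_pdmul IH.
Qed.

Lemma map_diffop1 : map_diffop 1 = 1.
Proof. exact: map_diffop_mon. Qed.

End MapDiffOp.

Section QuotientRule.
Variable F : fieldType.
Implicit Types p q r s : F.

Lemma quotB p q r s : q != 0 -> s != 0 ->
  p / q - r / s = (p * s - r * q) / (q * s).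
Proof. by move=> q0 s0; field; rewrite q0 s0. Qed.

Lemma quotDB p q r s p' q' r' s' : q != 0 -> s != 0 ->
  ((p' * s + p * s' - (r' * q + r * q')) * (q * s) -
     (p * s - r * q) * (q' * s + q * s')) / ((q * s) * (q * s)) =
  (p' * q - p * q') / (q * q) - (r' * s - r * s') / (s * s).
Proof. by move=> q0 s0; field; rewrite q0 s0. Qed.

Lemma quotDM p q r s p' q' r' s' : q != 0 -> s != 0 ->
  ((p' * r + p * r') * (q * s) - p * r * (q' * s + q * s')) / ((q * s) * (q * s)) =
  (p' * q - p * q') / (q * q) * (r / s) + p / q * ((r' * s - r * s') / (s * s)).
Proof. by move=> q0 s0; field; rewrite q0 s0. Qed.

Lemma quotDC p q pi pj pij qi qj qij : q != 0 ->
  ((pij * q + pj * qi - (pi * qj + p * qij)) * (q * q)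
    - (pj * q - p * qj) * (qi * q + q * qi)) / ((q * q) * (q * q)) =
  ((pij * q + pi * qj - (pj * qi + p * qij)) * (q * q)
    - (pi * q - p * qi) * (qj * q + q * qj)) / ((q * q) * (q * q)).
Proof. by move=> q0; field; rewrite ?q0. Qed.

End QuotientRule.

Section FracDer.
Variables (n : nat) (T : idomainType) (D : derivations n T).
Local Notation "x %:F" := (@FracField.tofrac T x).

(* The quotient rule on a chosen representative; see fracderE for independence. *)
Definition fracder (i : 'I_n) (f : {fraction T}) : {fraction T} :=
  let p := (frac (repr f)).1 in let q := (frac (repr f)).2 in
  (D i p * q - p * D i q)%:F / (q ^+ 2)%:F.

Let derB i (x y : T) : D i (x - y) = D i x - D i y.
Proof. exact: raddfB. Qed.

Lemma fracE (f : {fraction T}) :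
  f = (frac (repr f)).1%:F / (frac (repr f)).2%:F.
Proof.
have d0 := denom_ratioP (repr f).
apply: (canRL (mulfK _)); first by rewrite tofrac_eq0.
rewrite -{1}[f]reprK; unlock FracField.tofrac.
rewrite -[LHS]FracField.pi_mul; apply/eqmodP => /=.
rewrite FracField.equivfE /FracField.mulf.
by rewrite !numden_Ratio ?(mulr1, mul1r, oner_neq0) // mulrC.
Qed.

Lemma fracP (f : {fraction T}) :
  exists p q, q != 0 /\ f = p%:F / q%:F.
Proof.
by exists (frac (repr f)).1, (frac (repr f)).2; split; [exact: denom_ratioP|exact: fracE].
Qed.

Lemma fracderE i p q : q != 0 ->
  fracder i (p%:F / q%:F) = (D i p * q - p * D i q)%:F / (q ^+ 2)%:F.
Proof.
move=> q0; rewrite /fracder; set f := p%:F / q%:F.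
have := fracE f; have := denom_ratioP (repr f).
move: (frac (repr f)).1 (frac (repr f)).2 => a b b0.
rewrite /f => /eqP; rewrite eqr_div ?tofrac_eq0 // -!tofracM tofrac_eq => /eqP E.
have /(congr1 (D i)) := E; rewrite !derM => E'.
apply/eqP; rewrite eqr_div ?tofrac_eq0 ?expf_neq0 // -!tofracM tofrac_eq.
apply/eqP.
have Ea : D i a * q = D i p * b + p * D i b - a * D i q by rewrite E' addrK.
have -> : (D i a * b - a * D i b) * q ^+ 2 =
  q * b * (D i a * q) - q * D i b * (a * q) by ring.
by rewrite Ea -E; transitivity (q * b ^+ 2 * D i p - b * D i q * (a * q));
  [|rewrite -E]; ring.
Qed.

Lemma fracder_is_additive i : zmod_morphism (fracder i).
Proof.
move=> f g.
have [p [q [q0 ->]]] := fracP f; have [r [s [s0 ->]]] := fracP g.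
have q0' : q%:F != 0 by rewrite tofrac_eq0.
have s0' : s%:F != 0 by rewrite tofrac_eq0.
have -> : p%:F / q%:F - r%:F / s%:F = (p * s - r * q)%:F / (q * s)%:F.
  by rewrite !(tofracB, tofracM) quotB.
rewrite !fracderE ?mulf_neq0 // !(derB, derM) !expr2.
by rewrite !(tofracB, tofracD, tofracM) quotDB.
Qed.

HB.instance Definition _ i := GRing.isZmodMorphism.Build
  {fraction T} {fraction T} (fracder i) (fracder_is_additive i).

Lemma fracderM i f g : fracder i (f * g) = fracder i f * g + f * fracder i g.
Proof.
have [p [q [q0 ->]]] := fracP f; have [r [s [s0 ->]]] := fracP g.
have q0' : q%:F != 0 by rewrite tofrac_eq0.
have s0' : s%:F != 0 by rewrite tofrac_eq0.
rewrite mulf_div -!tofracM !fracderE ?mulf_neq0 // !derM !expr2.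
by rewrite !(tofracB, tofracD, tofracM) quotDM.
Qed.

Lemma fracderC i j f : fracder i (fracder j f) = fracder j (fracder i f).
Proof.
have [p [q [q0 ->]]] := fracP f.
have q0' : q%:F != 0 by rewrite tofrac_eq0.
rewrite !fracderE ?expf_neq0 // !(raddfB, derM, expr2) (derC D i j p) (derC D i j q).
by rewrite /= !(tofracB, tofracD, tofracM) quotDC.
Qed.

Definition frac_derivations : derivations n {fraction T} :=
  Derivations fracderM fracderC.

Lemma fracder_tofrac i x : fracder i x%:F = (D i x)%:F.
Proof.
rewrite -[x%:F]divr1 -tofrac1 fracderE ?oner_neq0 //.
by rewrite der1 mulr0 subr0 expr1n mulr1 tofrac1 divr1.
Qed.

End FracDer.

Definition mpoly_derivations (n : nat) (C : fieldType) :
    derivations n (mpoly n C) :=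
  Derivations (@mderivM n C) (fun i j p => mderiv_comm j i p).

(* C<x_1,..,x_n,d_1,..,d_n> and C(x_1,..,x_n)<d_1,..,d_n> *)
Notation weyl n C := (diffop (mpoly_derivations n C)).
Notation ratdiffop n C := (diffop (frac_derivations (mpoly_derivations n C))).

Section Weyl.
Variables (n : nat) (C : fieldType).
Local Notation D := (mpoly_derivations n C).

Definition weylC (c : C) : weyl n C := dcoef D (mpolyC n c).
Definition weylX (j : 'I_n) : weyl n C := dcoef D (mpolyX C (mnm1 j)).
Definition weylD (j : 'I_n) : weyl n C := dpartial D j.

Definition weyl_rat : weyl n C -> ratdiffop n C :=
  map_diffop (frac_derivations D) (@FracField.tofrac (mpoly n C)).

Lemma weyl_ratM P Q : weyl_rat (P * Q) = weyl_rat P * weyl_rat Q.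
Proof. by apply: map_diffopM => i x; rewrite [RHS]fracder_tofrac. Qed.

End Weyl.

Definition left_ideal (T : nzRingType) (S : set T) : set T :=
  [set P | exists (m : nat) (q s : 'I_m -> T),
     (forall k, S (s k)) /\ P = \sum_(k < m) q k * s k].

(* The dimension of V / W, for W a subspace of V: the supremum in \bar R of the
   sizes of the finite families of V that are linearly independent modulo W. *)
Definition quotient_dim (R : realType) (K : fieldType) (V : lmodType K)
    (W : set V) : \bar R :=
  ereal_sup [set k%:R%:E | k in [set k : nat | exists v : 'I_k -> V,
    forall c : 'I_k -> K, W (\sum_(i < k) c i *: v i) -> forall i, c i = 0]].

Section GKZ.
Variables (d n : nat) (C : fieldType) (A : 'M[int]_(d, n)) (beta : 'cV[C]_d).

Definition euler_op (i : 'I_d) : weyl n C :=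
  \sum_(j < n) (weylX C j * weylD C j) *~ A i j - weylC n (beta i 0).

Definition toric_op (u v : 'cV[nat]_n) : weyl n C :=
  \prod_(j < n) weylD C j ^+ u j 0 - \prod_(j < n) weylD C j ^+ v j 0.

Definition gkz_ideal : set (weyl n C) :=
  left_ideal ([set P | exists i, P = euler_op i] `|`
    [set P | exists u v : 'cV[nat]_n,
       A *m map_mx Posz u = A *m map_mx Posz v /\ P = toric_op u v]).

End GKZ.

(* The dimension over C(x) of R / R H, where R = C(x)<d_1,..,d_n>. *)
Definition holonomic_rank (R : realType) (n : nat) (C : fieldType)
    (H : set (weyl n C)) : \bar R :=
  quotient_dim R (left_ideal (@weyl_rat n C @` H)).

Section Volume.
Variables (R : realType) (d : nat).

Definition box (a b : 'cV[R]_d) : set 'cV[R]_d :=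
  [set x | forall i, a i 0 <= x i 0 <= b i 0].

(* Lebesgue outer measure on R^d, which is the Euclidean volume on measurable
   sets (below it is only applied to a polytope). The coverings are indexed by
   an arbitrary set of naturals, so that finite ones are allowed: when d = 0
   every box is a point, of volume 1, and cannot serve as padding. *)
Definition euclidean_volume (S : set 'cV[R]_d) : \bar R :=
  ereal_inf [set v | exists (D : set nat) (a b : nat -> 'cV[R]_d),
    [/\ forall k i, a k i 0 <= b k i 0,
        S `<=` \bigcup_(k in D) box (a k) (b k)
      & v = \esum_(k in D) (\prod_(i < d) (b k i 0 - a k i 0))%:E]].

Definition convex_hull (S : set 'cV[R]_d) : set 'cV[R]_d :=
  smallest (@convex_set R 'cV[R]_d) S.

Definition normalized_volume (n : nat) (A : 'M[int]_(d, n)) : \bar R :=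
  let S := [set 0] `|` range (fun j : 'I_n => map_mx intr (col j A)) in
  ((d`!)%:R%:E * euclidean_volume (convex_hull S))%E.

End Volume.

(* Main.v *)
From HB Require Import structures.
Require Import Defs.
From mathcomp Require Import all_boot all_order all_algebra fraction zify ring lra.
From mathcomp Require Import complex.
From mathcomp Require mpoly.
From mathcomp Require Import all_classical all_reals all_analysis.
Import -(notations) mpoly.

(** Write [K] for [C(x)] and [S] for the semigroup ring [K[NA]], spanned over [K]
   by the monomials [s^(A u)].

   The map [c d^u |-> c s^(A u)] sends [R] onto [S] and kills the left ideal
   generated by the toric operators. Right multiplication by the [i]-th Euler
   operator becomes an operator [E_i] on [S] with
   [E_i s^al = (al_i - beta_i) s^al + \sum_j a_ij x_j s^(al + a_j)]
   ([symbol_euler]). Hence the rank is at least [dim_K S / \sum_i E_i S], and the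
   [E_i] commute ([eulerC]), so that [S] is a module over [K[E_1, ..., E_d]] and
   this quotient is its fibre at the origin.

   The fibre dimension of a finitely generated module is upper semicontinuous, so
   it is at least the generic rank, which shows in the growth of [S] along the
   filtration [S_k], the span of the [s^(A u)] with [|u| <= k]. In elementary
   terms: if [g_1, ..., g_r] span the fibre, the determinant trick gives a nonzero
   polynomial [f] in the [E_i] mapping the generators of [S] into
   [\sum_i K[E] g_i] ([fibre_generates]); division by [f] then shows that
   [dim S_k] is at most [r k^d / d!] up to lower-order terms ([growth_card],
   [card_reach_le]). Fibres can only jump upwards, so that special values of
   [beta] raise the rank and never lower it.

   On the other side, rounding coefficients shows that [conv(0, A)] is covered by
   about [dim S_k] cubes of edge [1/k] ([volume_le_reach]), because the columns of
   [A] generate [Z^d]. Letting [k] tend to infinity gives [vol(A) <= r].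

   What remains is that [S] is finitely generated over [K[E]], compatibly with the
   filtration: for some [k0], [S_(k+1) = S_k + \sum_i E_i S_k] for [k >= k0]
   ([generic_generation], [deltas_euler_degree]). It is here that the [x_j] have to
   be indeterminates. If this failed, a linear form [lambda] on [S_(k0+1)] would
   vanish on the right-hand side but not identically; clear denominators and let
   [L(al, m)] be the coefficient of [x^m] in [lambda(s^al)]. Then
   [\sum_j a_ij L(A w + a_j, m - e_j) = 0] for every [w] of degree [k0] and every
   [m]. These relations force [L(A u, m) = 0] by induction on [u + m] in a
   monomial order ([coefficients_vanish]): when the large coordinates of [u] lie
   on linearly dependent columns, a relation between these replaces [u] by a
   smaller exponent of the same weight; when they lie on independent columns, a
   dual vector turns the relations into one that moves degree out of these
   columns, until the set of large coordinates grows. This replaces the usual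
   appeal to regular triangulations and to the nondegeneracy of generic Laurent
   polynomials. *)

Set Implicit Arguments.
Unset Strict Implicit.
Unset Printing Implicit Defensive.

Import Order.TTheory GRing.Theory Num.Theory.

Local Open Scope ring_scope.

(** * Linear algebra in arbitrary modules *)

Section Span.
Variables (K : nzRingType) (V : lmodType K).
Implicit Types (S : V -> Prop) (v w : V).

Inductive lspan S : V -> Prop :=
| lspan0 : lspan S 0
| lspan_cons c w v : S w -> lspan S v -> lspan S (c *: w + v).

Lemma lspan_gen S w : S w -> lspan S w.
Proof.
by move=> Sw; rewrite -[w]addr0 -[w]scale1r; apply: lspan_cons => //; exact: lspan0.
Qed.

Lemma lspanD S v w : lspan S v -> lspan S w -> lspan S (v + w).
Proof.
by move=> + Sw; elim=> [|c u x Su _ IH]; rewrite ?add0r // -addrA; exact: lspan_cons.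
Qed.

Lemma lspanZ S c v : lspan S v -> lspan S (c *: v).
Proof.
elim=> [|b u x Su _ IH]; first by rewrite scaler0; exact: lspan0.
by rewrite scalerDr scalerA; exact: lspan_cons.
Qed.

Lemma lspanB S v w : lspan S v -> lspan S w -> lspan S (v - w).
Proof. by move=> hv hw; rewrite -scaleN1r; apply: lspanD => //; exact: lspanZ. Qed.

Lemma lspan_sum S (I : Type) (r : seq I) (P : pred I) (F : I -> V) :
  (forall i, P i -> lspan S (F i)) -> lspan S (\sum_(i <- r | P i) F i).
Proof. by move=> h; apply: big_ind => //; [exact: lspan0|exact: lspanD]. Qed.

Lemma lspan_trans S S' v : (forall w, S w -> lspan S' w) -> lspan S v -> lspan S' v.
Proof.
move=> h; elim=> [|c w x /h hw _ IH]; first exact: lspan0.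
by apply: lspanD => //; exact: lspanZ.
Qed.

Lemma lspan_fin (I : finType) (w : I -> V) v :
  lspan (fun x => exists i, x = w i) v -> exists c : I -> K, v = \sum_i c i *: w i.
Proof.
elim=> [|b x y [i ->] _ [c ->]].
  by exists (fun=> 0); rewrite big1 // => i _; rewrite scale0r.
exists (fun j => (if j == i then b else 0) + c j).
under [RHS]eq_bigr do rewrite scalerDl.
rewrite big_split /= [in RHS](bigD1 i) //= eqxx [X in _ = _ + X + _]big1 ?addr0 //.
by move=> j /negPf ->; rewrite scale0r.
Qed.

End Span.

Lemma lspan_image (K : nzRingType) (V W : lmodType K) (f : {linear V -> W})
    (S : V -> Prop) (S' : W -> Prop) v :
  (forall w, S w -> lspan S' (f w)) -> lspan S v -> lspan S' (f v).
Proof.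
move=> h; elim=> [|c w x /h hw _ IH]; first by rewrite linear0; exact: lspan0.
by rewrite linearP; apply: lspanD => //; exact: lspanZ.
Qed.

Definition lin_indep (K : nzRingType) (V : lmodType K) (J : finType) (y : J -> V) :=
  forall c : J -> K, \sum_j c j *: y j = 0 -> forall j, c j = 0.

Lemma card_lin_indep (K : fieldType) (V : lmodType K) (I J : finType)
    (w : I -> V) (y : J -> V) : lin_indep y ->
  (forall j, lspan (fun x => exists i, x = w i) (y j)) -> (#|J| <= #|I|)%N.
Proof.
move=> ind sp; have /choice[c hc] j := lspan_fin (sp j).
pose M : 'M[K]_(#|J|, #|I|) := \matrix_(j, i) c (enum_val j) (enum_val i).
suff : row_free M by rewrite /row_free => /eqP <-; exact: rank_leq_col.
rewrite -kermx_eq0; apply/eqP/row_matrixP => k; rewrite row0.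
have : row k (kermx M) *m M = 0 by rewrite -row_mul mulmx_ker row0.
move: (row k _) => x x0; apply/rowP => j; rewrite mxE.
rewrite -[j]enum_valK; apply: (ind (fun j0 => x 0 (enum_rank j0))).
under eq_bigr do rewrite hc scaler_sumr.
rewrite exchange_big big1 //= => i _.
under eq_bigr do rewrite scalerA.
rewrite -scaler_suml (_ : \sum_j0 _ = 0) ?scale0r //.
have /matrixP/(_ 0 (enum_rank i)) := x0; rewrite !mxE => {2}<-.
rewrite (reindex_onto enum_val enum_rank) /= => [|j0 _]; last by rewrite enum_rankK.
by apply: eq_big => [j0|j0 _]; rewrite ?enum_valK ?eqxx // mxE enum_rankK.
Qed.

Section LinearExtension.
Variables (n : nat) (K : comNzRingType) (V : lmodType K) (phi : multinom n -> V).

Definition linext (p : mpoly n K) : V := \sum_(u <- msupp p) mcoeff u p *: phi u.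

Lemma linextEw p (s : seq (multinom n)) : uniq s -> {subset msupp p <= s} ->
  linext p = \sum_(u <- s) mcoeff u p *: phi u.
Proof.
move=> us sub; rewrite /linext.
rewrite [RHS](bigID (fun u => u \in msupp p)) /= [X in _ + X]big1 ?addr0.
  rewrite -[RHS]big_filter; apply: perm_big.
  apply: (uniq_perm (msupp_uniq p) (filter_uniq _ us)) => u.
  by rewrite mem_filter; case: (boolP (u \in msupp p)) => //= /sub.
by move=> u /memN_msupp_eq0 ->; rewrite scale0r.
Qed.

Lemma linext_is_linear : linear linext.
Proof.
move=> c p q; pose s := undup (msupp p ++ msupp q ++ msupp (c *: p + q)).
have us : uniq s by exact: undup_uniq.
rewrite !(@linextEw _ s us); first last.
- by move=> u; rewrite mem_undup !mem_cat => ->; rewrite ?orbT.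
- by move=> u; rewrite mem_undup !mem_cat => ->; rewrite ?orbT.
- by move=> u; rewrite mem_undup !mem_cat => ->; rewrite ?orbT.
rewrite scaler_sumr -big_split; apply: eq_bigr => u _.
by rewrite mcoeffD mcoeffZ scalerDl scalerA.
Qed.

HB.instance Definition _ := GRing.isLinear.Build K (mpoly n K) V _ linext
  linext_is_linear.

Lemma linextX u : linext (mpolyX K u) = phi u.
Proof. by rewrite /linext msuppX big_seq1 mcoeffX eqxx scale1r. Qed.

End LinearExtension.

(** * Polynomials in commuting operators *)

Section CommutingOperators.
Variables (d : nat) (K : comNzRingType) (V : lmodType K).
Variable E : 'I_d -> {linear V -> V}.
Hypothesis EC : forall i j v, E i (E j v) = E j (E i v).
Implicit Types (u w : multinom d) (p q : mpoly d K) (v : V).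

Definition epow u v : V := foldr (fun i => iter (u i) (E i)) v (enum 'I_d).

Lemma iter_linear (f : {linear V -> V}) k : linear (iter k f).
Proof. by move=> c x y; elim: k => //= k ->; rewrite linearP. Qed.

Lemma epow_is_linear u : linear (epow u).
Proof.
move=> c x y; rewrite /epow; elim: (enum _) => //= i s ->.
exact: iter_linear.
Qed.

HB.instance Definition _ u := GRing.isLinear.Build K V V _ (epow u)
  (epow_is_linear u).

Lemma epow0 v : epow mnm0 v = v.
Proof. by rewrite /epow; elim: (enum _) => //= i s ->; rewrite mnm0E. Qed.

Lemma iter_opC i j k l v :
  iter k (E i) (iter l (E j) v) = iter l (E j) (iter k (E i) v).
Proof.
elim: k => //= k ->; elim: l (iter k _ v) => //= l IH x.
by rewrite EC IH.
Qed.

Lemma epowS i u v : epow (mnm_add u (mnm1 i)) v = E i (epow u v).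
Proof.
rewrite /epow; have : uniq (enum 'I_d) by exact: enum_uniq.
have : i \in enum 'I_d by rewrite mem_enum.
elim: (enum _) => //= j s IH; rewrite inE => + /andP[js us].
have [eij _|ij /= si] := eqVneq i j; first subst j.
  rewrite mnmDE mnm1E eqxx addn1 /=; congr (E i (iter _ _ _)).
  move: js; elim: {IH us}s => //= k s IH; rewrite inE negb_or => /andP[ik si].
  by rewrite mnmDE mnm1E (negPf ik) addn0 IH.
rewrite mnmDE mnm1E (negPf ij) addn0 IH //.
by rewrite -[E i _]/(iter 1 (E i) _) iter_opC.
Qed.

Lemma epowD u w v : epow (mnm_add u w) v = epow u (epow w v).
Proof.
elim/mnm_indU: u => [|u i IH]; first by rewrite add0m epow0.
by rewrite -addmA [mnm_add (mnm1 i) w]addmC addmA !epowS IH.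
Qed.

Lemma epow1 i v : epow (mnm1 i) v = E i v.
Proof. by rewrite -[mnm1 i]add0m epowS epow0. Qed.

Definition act p v : V := linext (fun u => epow u v) p.

Lemma act_is_linear p : linear (act p).
Proof.
move=> c x y; rewrite /act /linext scaler_sumr -big_split; apply: eq_bigr => u _.
by rewrite linearP scalerDr !scalerA mulrC.
Qed.

HB.instance Definition _ p := GRing.isLinear.Build K V V _ (act p)
  (act_is_linear p).

Lemma actX u v : act (mpolyX K u) v = epow u v.
Proof. exact: linextX. Qed.

Lemma actDl p q v : act (p + q) v = act p v + act q v.
Proof. exact: linearD. Qed.

Lemma actZl c p v : act (c *: p) v = c *: act p v.
Proof. exact: linearZ. Qed.

Lemma act_suml (I : Type) (r : seq I) (P : pred I) (F : I -> mpoly d K) v :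
  act (\sum_(i <- r | P i) F i) v = \sum_(i <- r | P i) act (F i) v.
Proof. exact: linear_sum. Qed.

Lemma act0l v : act 0 v = 0.
Proof. exact: linear0. Qed.

Lemma act1l v : act 1 v = v.
Proof. by rewrite -mpolyX0 actX epow0. Qed.

Lemma actM p q v : act (p * q) v = act p (act q v).
Proof.
elim/mpolyind: p => [|c u p _ _ IH]; first by rewrite mul0r !act0l.
rewrite mulrDl !actDl IH -scalerAl !actZl actX; congr (_ *: _ + _) => {p IH}.
elim/mpolyind: q => [|b w q _ _ IH]; first by rewrite mulr0 !act0l linear0.
by rewrite mulrDr !actDl linearD IH -scalerAr !actZl linearZ /= -mpolyXD !actX epowD.
Qed.

Lemma act_lspan p v c : (msize p <= c)%N ->
  lspan (fun x => exists u, (mdeg u < c)%N /\ x = epow u v) (act p v).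
Proof.
move=> hp; rewrite /act /linext big_seq_cond; apply: lspan_sum => u; rewrite andbT => up.
apply: lspanZ; apply: lspan_gen; exists u; split => //.
exact: leq_trans (msize_mdeg_lt up) hp.
Qed.

(** The determinant trick behind Nakayama's lemma: multiply [(1 - M) N = y] by the
   adjugate of [1 - M]. *)
Lemma act_det (s : nat) (M : 'M[mpoly d K]_s) (N y : 'I_s -> V) :
  (forall a, N a = y a + \sum_b act (M a b) (N b)) ->
  forall a, act (\det (1%:M - M)) (N a) = \sum_b act ((\adj (1%:M - M)) a b) (y b).
Proof.
move=> h a; set M' := 1%:M - M.
have hy b : y b = \sum_c act (M' b c) (N c).
  under eq_bigr => c _ do rewrite !mxE actDl -scaleN1r actZl.
  rewrite big_split /= -scaler_sumr scaleN1r (bigD1 b) //= eqxx act1l.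
  rewrite [X in _ + X - _]big1 ?addr0 => [|c /negPf cb].
    by rewrite [X in X - _]h addrK.
  by rewrite eq_sym cb act0l.
under [RHS]eq_bigr => b _ do rewrite hy linear_sum.
rewrite exchange_big /=.
under [RHS]eq_bigr => c _.
  under eq_bigr => b _ do rewrite /= -actM.
  rewrite -act_suml (_ : \sum_b _ = (\adj M' *m M') a c); last by rewrite mxE.
  rewrite mul_adj_mx mxE; over.
rewrite (bigD1 a) //= eqxx big1 ?addr0 // => c /negPf ca.
by rewrite eq_sym ca mulr0n act0l.
Qed.

End CommutingOperators.

Section Growth.
Variables (d : nat) (K : fieldType) (V : lmodType K).
Variable E : 'I_d -> {linear V -> V}.
Hypothesis EC : forall i j v, E i (E j v) = E j (E i v).
Local Notation epow := (epow E).
Local Notation act := (act E).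

(** Division by [f]: a monomial divisible by the leading monomial of [f] is
   replaced by smaller ones and by a multiple of [f]. *)
Lemma epow_reduce (f : mpoly d K) r (g : 'I_r -> V) (h : 'I_r -> mpoly d K) c v k :
  f != 0 -> (forall i, (msize (h i) <= c.+1)%N) ->
  act f v = \sum_i act (h i) (g i) ->
  forall m, (mdeg m <= k + mdeg (mlead f))%N ->
  lspan (fun w => (exists i u, (mdeg u <= k + c)%N /\ w = epow u (g i)) \/
    exists u, [/\ (mdeg u <= k + mdeg (mlead f))%N, ~~ lem (mlead f) u
      & w = epow u v]) (epow m v).
Proof.
move=> f0 hc hf; set G := (X in lspan X); set l := mlead f.
elim/(well_founded_ind (@ltom_wf d)) => m IH mk.
have [lm|nlm] := boolP (lem l m); last first.
  by apply: lspan_gen; right; exists m; split.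
have hq : mdeg m = (mdeg (mnm_sub m l) + mdeg l)%N by rewrite -mdegD submK.
have : lspan G (epow (mnm_sub m l) (act f v)).
  rewrite hf linear_sum; apply: lspan_sum => i _.
  apply: lspan_image (act_lspan E _ (hc i)) => w [u [uc ->]].
  apply: lspan_gen; left; exists i, (mnm_add (mnm_sub m l) u); split.
    by rewrite mdegD; apply: leq_add; [move: mk; rewrite hq leq_add2r|].
  by rewrite epowD.
rewrite {1}/act /linext linear_sum /= (bigD1_seq l) ?mlead_supp ?msupp_uniq //=.
rewrite linearZ /= -epowD // submK // => hs.
have cl : mcoeff l f != 0 by rewrite mleadc_eq0.
rewrite -[epow m v]scale1r -(mulVf cl) -scalerA; apply: lspanZ.
rewrite -[X in lspan _ X](addrK (\sum_(u <- msupp f | u != l)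
  epow (mnm_sub m l) (mcoeff u f *: epow u v))).
apply: lspanB => //; rewrite big_seq_cond; apply: lspan_sum => u /andP[uf ul].
rewrite linearZ /= -epowD //; apply: lspanZ.
have lt : (mnm_add (mnm_sub m l) u < m)%O.
  rewrite -[X in (_ < X)%O](submK lm) ltmc_add2r lt_neqAle ul; exact: msupp_le_mlead.
by apply: IH => //; apply: leq_trans mk; apply: lemc_mdeg; exact: ltW.
Qed.

(** Nakayama's lemma at the origin, without localization: if [g] spans the fibre at
   the origin of the module generated by [N], a polynomial [f] with [f(0) = 1] maps
   this module into the one generated by [g]. *)
Lemma fibre_generates q r (N : 'I_q -> V) (g : 'I_r -> V) :
  (forall a, exists (kappa : 'I_r -> K) (p : 'I_d -> 'I_q -> mpoly d K),
    N a = \sum_i kappa i *: g i + \sum_i E i (\sum_b act (p i b) (N b))) ->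
  exists (f : mpoly d K) (h : 'I_q -> 'I_r -> mpoly d K), f != 0 /\
    forall a, act f (N a) = \sum_i act (h a i) (g i).
Proof.
move=> /choice[kappa /choice[p hp]].
pose M : 'M[mpoly d K]_q := \matrix_(a, b) \sum_i mpolyX K (mnm1 i) * p a i b.
pose y a := \sum_i kappa a i *: g i.
have hN a : N a = y a + \sum_b act (M a b) (N b).
  rewrite {1}hp; congr (_ + _).
  under [RHS]eq_bigr => b _ do rewrite mxE act_suml.
  rewrite exchange_big; apply: eq_bigr => i _; rewrite linear_sum.
  by apply: eq_bigr => b _; rewrite /= actM // actX epow1.
exists (\det (1%:M - M)).
exists (fun a i => \sum_b kappa b i *: (\adj (1%:M - M)) a b); split => [|a].
  (* [M] vanishes at the origin, so that [det (1 - M)] takes the value 1 there. *)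
  apply: contra_neq (oner_neq0 K) => det0.
  have := det_map_mx (@mcoeff d K mnm0) (1%:M - M); rewrite det0 rmorph0.
  rewrite map_mxB map_mx1 (_ : map_mx _ M = 0) ?subr0 ?det1 //.
  apply/matrixP => a b; rewrite !mxE /= raddf_sum big1 // => i _.
  by rewrite /= rmorphM /= mcoeffX mnm1_eq0 mul0r.
rewrite (act_det EC hN); under eq_bigr => b _ do rewrite /y linear_sum.
rewrite exchange_big; apply: eq_bigr => i _; rewrite act_suml.
by apply: eq_bigr => b _; rewrite /= linearZ actZl.
Qed.

End Growth.

(** * Counting *)

Lemma card_bmultinom d N : #|{: bmultinom d N.+1}| = 'C(d + N, d).
Proof.
rewrite -card_partial_ord_partitions -cardsT.
pose f (u : bmultinom d N.+1) : d.-tuple 'I_N.+1 := [tuple inord (u i) | i < d].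
have ule (u : bmultinom d N.+1) i : (u i < N.+1)%N.
  apply: leq_ltn_trans (bmdeg u); rewrite mdegE (bigD1 i) //=; exact: leq_addr.
have fE u i : tnth (f u) i = u i :> nat by rewrite tnth_mktuple inordK.
have finj : injective f.
  move=> u v /(congr1 (fun t i => nat_of_ord (tnth t i))) E.
  apply/eqP; rewrite bmeqP; apply/eqP/mnmP => i.
  by have := congr1 (fun g => g i) E; rewrite !fE.
rewrite -(card_imset _ finj); apply: eq_card => t; rewrite inE; apply/imsetP/idP.
  move=> [u _ ->]; rewrite big_tuple; under eq_bigr do rewrite fE.
  by rewrite -mdegE -ltnS bmdeg.
move=> tN; pose u : multinom d := Multinom [tuple nat_of_ord (tnth t i) | i < d].
have uE i : u i = tnth t i by rewrite multinomE tnth_mktuple.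
have uN : (mdeg u < N.+1)%N.
  by move: tN; rewrite big_tuple mdegE ltnS; under [in X in _ -> X]eq_bigr do rewrite uE.
exists (BMultinom uN) => //; apply/eq_from_tnth => i; apply: ord_inj.
by rewrite fE /= uE.
Qed.

(** Multiples of [l] correspond to monomials of degree at most [k], so that the
   others are of lower order in [k]. *)
Lemma card_not_lem d (l : multinom d) k :
  (#|[pred u : bmultinom d (k + mdeg l).+1 | ~~ lem l u]|
    <= 'C(d + (k + mdeg l), d) - 'C(d + k, d))%N.
Proof.
rewrite leq_subRL -?card_bmultinom; last first.
  rewrite !card_bmultinom; apply: leq_bin2l; lia.
rewrite -[X in (_ <= X)%N](cardC [pred u : bmultinom d _ | lem l u]) leq_add2r.
have uN (u : bmultinom d k.+1) : (mdeg (mnm_add u l) < (k + mdeg l).+1)%N.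
  by rewrite mdegD ltnS leq_add2r -ltnS bmdeg.
pose f u := BMultinom (uN u).
have finj : injective f.
  move=> u v /(congr1 (fun w => bmnm w)) /= /eqP; rewrite eqm_add2r => /eqP E.
  by apply/eqP; rewrite bmeqP E.
rewrite -cardsT -(card_imset _ finj); apply: subset_leq_card.
by apply/fintype.subsetP => _ /imsetP[u _ ->]; rewrite inE /= lem_addl.
Qed.

(** A module generated by [N] whose fibre at the origin is spanned by [r] elements
   has growth at most [r k^d / d!] to leading order. Modulo the elements generated
   by [g], only the monomials not divisible by the leading monomial of [f] act on
   [N] ([epow_reduce]), and these contribute to lower order: torsion in the module
   does no harm. *)
Lemma growth_card (d : nat) (K : fieldType) (V : lmodType K)
    (E : 'I_d -> {linear V -> V})
    (EC : forall i j v, E i (E j v) = E j (E i v))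
    q r (N : 'I_q -> V) (g : 'I_r -> V) :
  (forall a, exists (kappa : 'I_r -> K) (p : 'I_d -> 'I_q -> mpoly d K),
    N a = \sum_i kappa i *: g i + \sum_i E i (\sum_b act E (p i b) (N b))) ->
  exists c e : nat, forall k (J : finType) (y : J -> V), lin_indep y ->
    (forall j, lspan (fun x => exists a u, (mdeg u <= k + e)%N /\ x = epow E u (N a))
      (y j)) ->
    (#|J| <= r * 'C(d + (k + c), d) +
      q * ('C(d + (k + e), d) - 'C(d + k, d)))%N.
Proof.
move=> /(fibre_generates EC)[f [h [f0 hf]]].
pose c := \max_a \max_i msize (h a i); exists c, (mdeg (mlead f)) => k J y ind sp.
have hc a i : (msize (h a i) <= c.+1)%N.
  apply: leqW; apply: leq_trans (leq_bigmax a); exact: (leq_bigmax i).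
set l := mlead f in sp *.
pose I := ('I_r * bmultinom d (k + c).+1 +
  'I_q * {u : bmultinom d (k + mdeg l).+1 | ~~ lem l u})%type.
pose w (i : I) := match i with
  | inl iu => epow E iu.2 (g iu.1) | inr au => epow E (val au.2) (N au.1) end.
have := @card_lin_indep _ _ I J w y ind.
rewrite card_sum !card_prod !card_ord card_sig card_bmultinom => H.
apply: leq_trans (H _) _; last by rewrite leq_add2l leq_mul2l card_not_lem orbT.
move=> j; apply: lspan_trans (sp j) => x [a [m [hm ->]]].
apply: lspan_trans (epow_reduce EC f0 (hc a) (hf a) hm) => z [[i [u [hu ->]]]|].
  apply: lspan_gen; have hu' : (mdeg u < (k + c).+1)%N by [].
  by exists (inl (i, BMultinom hu')).
move=> [u [hu nlu ->]]; have hu' : (mdeg u < (k + mdeg l).+1)%N by [].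
apply: lspan_gen; exists (inr (a, exist _ (BMultinom hu') nlu)); by [].
Qed.

Lemma leq_expn2r m n k : (m <= n)%N -> (m ^ k <= n ^ k)%N.
Proof. by move=> mn; elim: k => // k IH; rewrite !expnS leq_mul. Qed.

Lemma expn_ffact_le n m : (n ^ m <= (n + m) ^_ m)%N.
Proof.
elim: m => [|m IH]; first by rewrite ffactn0.
rewrite addnS ffactSS expnS; apply: leq_mul => //; lia.
Qed.

Lemma ffact_le_expn n m : (n ^_ m <= n ^ m)%N.
Proof.
elim: m => [|m IH]; first by rewrite ffactn0.
by rewrite ffactnSr expnSr; apply: leq_mul => //; exact: leq_subr.
Qed.

Lemma binomial_growth r q d k c e : 
  (d`! * (r * 'C(d + (k + c), d) + q * ('C(d + (k + e), d) - 'C(d + k, d)))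
   <= r * (k + (c + e + d)) ^ d + q * ((k + (c + e + d)) ^ d - k ^ d))%N.
Proof.
have fb N : (d`! * 'C(N, d) = N ^_ d)%N by rewrite mulnC bin_ffact.
have up a : (a <= c + e)%N -> ((d + (k + a)) ^_ d <= (k + (c + e + d)) ^ d)%N.
  move=> ae; apply: leq_trans (ffact_le_expn _ _) _; apply: leq_expn2r; lia.
rewrite mulnDr ![(d`! * (_ * _))%N]mulnCA mulnBr !fb.
apply: leq_add; rewrite leq_mul2l ?up ?leq_addr ?orbT //.
by rewrite leq_sub ?up ?leq_addl ?orbT // addnC expn_ffact_le.
Qed.

Section Limit.
Variable R : realType.

Lemma expr1D_le (t : R) d : 0 <= t <= 1 -> (1 + t) ^+ d <= 1 + (3 ^ d)%:R * t.
Proof.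
move=> /andP[t0 t1]; elim: d => [|d IH]; first by rewrite expr0 mul1r lerDl.
rewrite exprSr; apply: le_trans (ler_wpM2r _ IH) _; first by rewrite addr_ge0.
have : 1 <= (3 ^ d)%:R :> R by rewrite ler1n expn_gt0.
rewrite expnS natrM; set a := (3 ^ d)%:R => a1.
have : a * (t * t) <= a * t.
  by rewrite ler_wpM2l ?(le_trans ler01) // -[leRHS]mulr1 ler_wpM2l.
nra.
Qed.

Lemma le_limit_ratio (x : \bar R) (r q d c : nat) :
  (forall k, (0 < k)%N ->
    (x <= ((r * (k + c) ^ d + q * ((k + c) ^ d - k ^ d))%N%:R / k%:R ^+ d)%:E)%E) ->
  (x <= r%:R%:E)%E.
Proof.
move=> H; apply/lee_addgt0Pr => eps eps0.
pose b : R := ((r + q) * 3 ^ d * c)%N%:R.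
have [k kP] : exists k : nat, b / eps < k%:R.
  exists (Num.bound (b / eps)); apply: archi_boundP.
  by rewrite divr_ge0 // ?ler0n // ltW.
pose m := (k + c).+1; have m0 : (0 < m)%N by [].
apply: le_trans (H m m0) _; rewrite -EFinD lee_fin.
have mR : 0 < m%:R :> R by rewrite ltr0n.
have mle : (m ^ d <= (m + c) ^ d)%N by rewrite leq_expn2r ?leq_addr.
rewrite natrD !natrM natrB // !natrX natrD.
have -> : (m%:R + c%:R : R) = m%:R * (1 + c%:R / m%:R).
  by rewrite mulrDr mulr1 mulrCA divff ?mulr1 // lt0r_neq0.
rewrite exprMn; set t := c%:R / m%:R.
have t01 : 0 <= t <= 1.
  rewrite divr_ge0 ?ler0n //= ler_pdivrMr // mul1r ler_nat /m; lia.
have md0 : m%:R ^+ d != 0 :> R by rewrite expf_neq0 // lt0r_neq0.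
rewrite (_ : _ / _ = r%:R * (1 + t) ^+ d + q%:R * ((1 + t) ^+ d - 1)); last first.
  by field.
have le1 := expr1D_le d t01.
have le2 : (r%:R + q%:R) * ((3 ^ d)%:R * t) <= eps.
  have -> : (r%:R + q%:R) * ((3 ^ d)%:R * t) = b / m%:R.
    by rewrite /b /t !natrM natrD; ring.
  rewrite ler_pdivrMr // -ler_pdivrMl // mulrC; apply: ltW; apply: lt_le_trans kP _.
  by rewrite ler_nat /m; lia.
have : r%:R * (1 + t) ^+ d <= r%:R * (1 + (3 ^ d)%:R * t) by rewrite ler_wpM2l.
have : q%:R * ((1 + t) ^+ d - 1) <= q%:R * ((3 ^ d)%:R * t).
  by rewrite ler_wpM2l // lerBlDl.
lra.
Qed.

End Limit.

(** * Twisted Euler operators *)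

Section TwistedEuler.
Variables (d n : nat) (K : fieldType) (A : 'M[int]_(d, n)).
Variables (x : 'I_n -> K) (b : 'I_d -> K).
Local Notation T := ('cV[int]_d -> K^o).
Implicit Types (al ga : 'cV[int]_d) (g : T) (u : multinom n).

Definition delta al : T := fun ga => (ga == al)%:R.

Definition weight u : 'cV[int]_d := A *m \col_j (u j)%:Z.

Lemma weightD u v : weight (mnm_add u v) = weight u + weight v.
Proof.
by rewrite /weight -mulmxDr; congr mulmx; apply/colP => j; rewrite !mxE mnmDE PoszD.
Qed.

Lemma weight1 j : weight (mnm1 j) = col j A.
Proof.
apply/colP => i; rewrite !mxE (bigD1 j) //= mxE mnm1E eqxx mulr1 big1 ?addr0 //.
by move=> l /negPf lj; rewrite mxE mnm1E eq_sym lj mulr0.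
Qed.

(** With [F = \sum_j x_j s^(a_j)], this is the operator
   [e^-F (s_i d/ds_i - b_i) e^F] on Laurent series in [s]. *)
Definition euler i (g : T) : T := fun al =>
  ((al i 0)%:~R - b i) * g al +
  \sum_j (A i j)%:~R * x j * g (al - col j A).

Lemma euler_is_linear i : linear (euler i).
Proof.
move=> c f g; apply/funext => al.
change (euler i (c *: f + g) al = c * euler i f al + euler i g al).
have fgE ga : (c *: f + g) ga = c * f ga + g ga by [].
rewrite /euler fgE [c * (_ + _)]mulrDr mulr_sumr addrACA -big_split /=.
congr (_ + _); first by ring.
by apply: eq_bigr => j _; rewrite fgE; ring.
Qed.

HB.instance Definition _ i := GRing.isLinear.Build K T T _ (euler i)
  (euler_is_linear i).

Lemma eulerC i k g : euler i (euler k g) = euler k (euler i g).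
Proof.
pose a (i : 'I_d) (al : 'cV[int]_d) : K := (al i 0)%:~R - b i.
pose p i j : K := (A i j)%:~R * x j.
have eulerE l h al : euler l h al = a l al * h al + \sum_j p l j * h (al - col j A) by [].
suff expand l m al : euler l (euler m g) al = a l al * a m al * g al +
    \sum_j (a l al * p m j + a m al * p l j - (A l j)%:~R * (A m j)%:~R * x j)
      * g (al - col j A) +
    \sum_j \sum_h p l j * p m h * g (al - col j A - col h A).
  apply/funext => al; rewrite !expand; congr (_ + _ + _); first by ring.
    by apply: eq_bigr => j _; ring.
  rewrite exchange_big; apply: eq_bigr => h _; apply: eq_bigr => j _.
  by rewrite [al - _ - _]addrAC; ring.
rewrite eulerE (eulerE m) mulrDr mulrA -!addrA; congr (_ + _).
rewrite mulr_sumr -!big_split; apply: eq_bigr => j _.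
rewrite /= eulerE mulrDr [p l j * \sum_h _]mulr_sumr addrA; congr (_ + _); last first.
  by apply: eq_bigr => h _; rewrite mulrA.
by rewrite /a /p !mxE rmorphB /=; ring.
Qed.

Lemma euler_delta i al : euler i (delta al) =
  ((al i 0)%:~R - b i) *: delta al +
  \sum_j ((A i j)%:~R * x j) *: delta (al + col j A).
Proof.
apply/funext => ga.
have scaleTE c f : (c *: f : T) ga = c * f ga by [].
rewrite [RHS](_ : _ = ((al i 0)%:~R - b i) * delta al ga +
  (\sum_j ((A i j)%:~R * x j) *: delta (al + col j A)) ga) // fct_sumE.
rewrite /euler; congr (_ + _).
  by rewrite /delta; have [->|] := eqVneq ga al; rewrite ?mulr0.
by apply: eq_bigr => j _; rewrite scaleTE /delta subr_eq.
Qed.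

Definition shift ga g : T := fun al => g (al - ga).

Lemma shift_is_linear ga : linear (shift ga).
Proof. by []. Qed.

HB.instance Definition _ ga := GRing.isLinear.Build K T T _ (shift ga)
  (shift_is_linear ga).

Lemma shift_delta ga al : shift ga (delta al) = delta (al + ga).
Proof. by apply/funext => be; rewrite /shift /delta subr_eq. Qed.

Lemma shift_euler ga i al : shift ga (euler i (delta al)) =
  euler i (delta (al + ga)) - (ga i 0)%:~R *: delta (al + ga).
Proof.
rewrite !euler_delta linearD linearZ linear_sum /= shift_delta addrAC -scalerBl.
congr (_ *: _ + _); first by rewrite mxE rmorphD /=; ring.
by apply: eq_bigr => j _; rewrite linearZ [al + ga + _]addrAC -(shift_delta ga (al + _)).
Qed.

Definition deltas k g := exists u, (mdeg u <= k)%N /\ g = delta (weight u).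

Definition deltas_euler k g := deltas k g \/ exists i g', deltas k g' /\ g = euler i g'.

Lemma lem_split u k : (k <= mdeg u)%N -> exists v w, u = mnm_add v w /\ mdeg v = k.
Proof.
elim: k => [|k IH] ku; first by exists mnm0, u; rewrite add0m mdeg0.
have [v [w [uE vk]]] := IH (ltnW ku).
have [i wi] : exists i, w i != 0%N.
  apply/existsP; apply: contraLR ku; rewrite negb_exists => /forallP w0.
  rewrite uE (_ : w = mnm0) ?addm0 ?vk ?ltnn //.
  by apply/mnmP => i; rewrite mnm0E; apply/eqP; rewrite -[_ == _]negbK.
exists (mnm_add v (mnm1 i)), (mnm_sub w (mnm1 i)).
by rewrite mdegD mdeg1 vk addn1 -addmA [mnm_add (mnm1 i) _]addmC submK ?lep1mP.
Qed.

(** Generation in one degree propagates to all higher ones, because the operators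
   commute with translations up to scalars ([shift_euler]). *)
Lemma deltas_euler_degree k0 k u :
  (forall v, mdeg v = k0.+1 -> lspan (deltas_euler k0) (delta (weight v))) ->
  (k0 <= k)%N -> mdeg u = k.+1 -> lspan (deltas_euler k) (delta (weight u)).
Proof.
move=> H k0k uk; have /lem_split[v [w [uE vk]]] : (k0.+1 <= mdeg u)%N by rewrite uk ltnS.
rewrite uE weightD -shift_delta.
have kE : k = (k0 + mdeg w)%N by move: uk; rewrite uE mdegD vk; lia.
apply: lspan_image (H v vk) => g [[v' [v'k ->]]|[i [_ [[v' [v'k ->]] ->]]]].
  apply: lspan_gen; left; exists (mnm_add v' w); split; first by rewrite mdegD kE leq_add2r.
  by rewrite weightD -shift_delta.
rewrite [X in lspan _ X](shift_euler _ i) -weightD.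
have dl : deltas k (delta (weight (mnm_add v' w))).
  by exists (mnm_add v' w); rewrite mdegD kE leq_add2r.
apply: lspanB; last by apply: lspanZ; apply: lspan_gen; left.
by apply: lspan_gen; right; exists i, (delta (weight (mnm_add v' w))).
Qed.

Definition eulerL i : {linear T -> T} := euler i.

Lemma eulerLC i k g : eulerL i (eulerL k g) = eulerL k (eulerL i g).
Proof. exact: eulerC. Qed.

(** The generators of [S] as a module over the Euler operators. *)
Definition low_delta k0 (a : 'I_#|{: bmultinom n k0.+1}|) : T :=
  delta (weight (enum_val a)).
Arguments low_delta : clear implicits.

Definition low_module k0 k g :=
  exists a v, (mdeg v <= k)%N /\ g = epow eulerL v (low_delta k0 a).

Lemma low_deltas_generate k0 :
  (forall v, mdeg v = k0.+1 -> lspan (deltas_euler k0) (delta (weight v))) ->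
  forall k u, (mdeg u <= k0 + k)%N -> lspan (low_module k0 k) (delta (weight u)).
Proof.
move=> H; elim=> [|k IH] u uk.
  have uk' : (mdeg u < k0.+1)%N by rewrite ltnS -(addn0 k0).
  apply: lspan_gen; exists (enum_rank (BMultinom uk')), mnm0.
  by rewrite mdeg0 epow0 /low_delta enum_rankK.
have mono w : (mdeg w <= k0 + k)%N -> lspan (low_module k0 k.+1) (delta (weight w)).
  move=> /IH; apply: lspan_trans => g [a [v [vk ->]]]; apply: lspan_gen.
  by exists a, v; rewrite leqW.
move: uk; rewrite addnS leq_eqVlt ltnS => /orP[/eqP uk|]; last exact: mono.
have := deltas_euler_degree H (leq_addr k k0) uk.
apply: lspan_trans => _ [[w [wk ->]]|[i [_ [[w [wk ->]] ->]]]]; first exact: mono.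
apply: (lspan_image (f := eulerL i)) (IH w wk) => _ [a [v [vk ->]]].
apply: lspan_gen; exists a, (mnm_add v (mnm1 i)).
by rewrite mdegD mdeg1 addn1 ltnS (epowS eulerLC).
Qed.

Lemma low_module_act k0 k g : lspan (low_module k0 k) g ->
  exists p, g = \sum_a act eulerL (p a) (low_delta k0 a).
Proof.
elim=> [|c _ h [a [u [uk ->]]] _ [p ->]].
  by exists (fun=> 0); rewrite big1 // => a _; rewrite act0l.
exists (fun a' => (if a' == a then c *: mpolyX K u else 0) + p a').
under [RHS]eq_bigr do rewrite actDl.
rewrite big_split /= [in RHS](bigD1 a) //= eqxx actZl actX.
rewrite [X in _ = _ + X + _]big1 ?addr0 // => a' /negPf ->.
by rewrite act0l.
Qed.

Definition reach k : seq 'cV[int]_d :=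
  undup [seq weight (bmnm v) | v <- enum {: bmultinom n k.+1}].

Lemma reachP k al : reflect (exists u, (mdeg u <= k)%N /\ al = weight u) (al \in reach k).
Proof.
rewrite mem_undup; apply: (iffP mapP) => [[u _ ->]|[u [uk ->]]].
  by exists (bmnm u); rewrite -ltnS bmdeg.
have uk' : (mdeg u < k.+1)%N by [].
by exists (BMultinom uk'); rewrite ?mem_enum.
Qed.

Lemma delta_lin_indep (s : seq 'cV[int]_d) : uniq s ->
  lin_indep (fun j : 'I_(size s) => delta (nth 0 s j)).
Proof.
move=> us c E j; have := congr1 (fun g : T => g (nth 0 s j)) E.
rewrite fct_sumE (bigD1 j) //= big1 ?addr0 => [|i ij].
  change (c j * delta (nth 0 s j) (nth 0 s j) = 0 -> c j = 0).
  by rewrite /delta eqxx mulr1.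
change (c i * delta (nth 0 s i) (nth 0 s j) = 0).
by rewrite /delta nth_uniq // eq_sym (inj_eq val_inj) (negPf ij) mulr0.
Qed.

Lemma card_reach_le k0 r (g : 'I_r -> T) :
  (forall v, mdeg v = k0.+1 -> lspan (deltas_euler k0) (delta (weight v))) ->
  (forall u, exists (kappa : 'I_r -> K) (Q : 'I_d -> T),
    (forall i, exists k, lspan (deltas k) (Q i)) /\
    delta (weight u) = \sum_i kappa i *: g i + \sum_i euler i (Q i)) ->
  exists q c e, forall k, (size (reach (k0 + (k + e))) <=
    r * 'C(d + (k + c), d) + q * ('C(d + (k + e), d) - 'C(d + k, d)))%N.
Proof.
move=> Hgen Hg; exists #|{: bmultinom n k0.+1}|.
have := @growth_card d K T eulerL eulerLC _ r (low_delta k0) g _.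
case=> [a|c [e H]]; last first.
  exists c, e => k.
  have := H k _ _ (delta_lin_indep (undup_uniq _ : uniq (reach (k0 + (k + e))))).
  rewrite card_ord; apply => j.
  have /reachP[u [uk ->]] := mem_nth 0 (ltn_ord j).
  exact: low_deltas_generate.
have [kappa [Q [QT hQ]]] := Hg (enum_val a).
have /choice[p hp] i : exists p, Q i = \sum_a act eulerL (p a) (low_delta k0 a).
  have [k hk] := QT i; apply: (@low_module_act k0 k).
  apply: lspan_trans hk => _ [u [uk ->]].
  by apply: low_deltas_generate => //; apply: leq_trans uk (leq_addl _ _).
exists kappa, p; rewrite [LHS]hQ; congr (_ + _); apply: eq_bigr => i _; by rewrite hp.
Qed.

End TwistedEuler.

(** * Genericity of the symbols of the Euler operators *)

Section Vanishing.
Variables (d n : nat) (A : 'M[int]_(d, n)).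
Local Notation weight := (weight A).
Implicit Types (u m q : multinom n) (t : {set 'I_n}).

Definition dependent t j := exists z : 'I_n -> int,
  [/\ z j != 0, forall l, l \notin t -> z l = 0 &
      forall i, \sum_l A i l * z l = 0].

(** Linear algebra over the rationals, so that a dependence yields integers and a
   dual vector can be used over any field of characteristic 0. *)
Lemma dependent_or_dual t j : j \in t -> dependent t j \/
  exists c : 'I_d -> rat, \sum_i c i * (A i j)%:~R = 1 /\
    forall l, l \in t -> l != j -> \sum_i c i * (A i l)%:~R = 0.
Proof.
move=> jt.
pose M : 'M[rat]_(n, d) := \matrix_(l, i) if (l \in t) && (l != j) then (A i l)%:~R else 0.
pose v : 'rV[rat]_d := \row_i (A i j)%:~R.
have [/submxP[y vE]|nvM] := boolP (v <= M)%MS; [left|right].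
  pose D := \prod_l denq (y 0 l).
  have D0 : D != 0 by apply/prodf_neq0 => l _; exact: denq_neq0.
  pose N l := numq (y 0 l) * \prod_(l' | l' != l) denq (y 0 l').
  have NE l : (N l)%:~R = D%:~R * y 0 l :> rat.
    have -> : D = denq (y 0 l) * \prod_(l' | l' != l) denq (y 0 l').
      by rewrite /D (bigD1 l).
    rewrite /N !intrM -[X in _ = _ * X](divq_num_den (y 0 l)).
    have d0 : (denq (y 0 l))%:~R != 0 :> rat by rewrite intr_eq0 denq_neq0.
    by field.
  exists (fun l => if l == j then - D else if l \in t then N l else 0); split.
  - by rewrite eqxx oppr_eq0.
  - by move=> l lt; rewrite (negPf lt); case: eqP lt => // ->; rewrite jt.
  move=> i; apply: (@intr_inj rat); rewrite rmorph_sum /= (bigD1 j) //= eqxx.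
  have := congr1 (fun w : 'rV[rat]_d => w 0 i) vE; rewrite !mxE => Aij.
  rewrite intrM intrN Aij mulrN mulr_suml (bigD1 j) //= !mxE eqxx andbF.
  rewrite mulr0 mul0r add0r -sumrN -big_split big1 //= => l lj.
  rewrite (negPf lj) !mxE lj andbT; case: ifP => _; last by rewrite !mulr0 mul0r oppr0 addr0.
  by rewrite intrM NE; ring.
move: nvM; rewrite submxE => /eqP vM.
have [k vk] : exists k, (v *m cokermx M) 0 k != 0.
  apply/existsP; apply: contra_notT vM; rewrite negb_exists => /forallP vM.
  by apply/rowP => k; rewrite [RHS]mxE; apply/eqP; rewrite -[_ == _]negbK.
exists (fun i => cokermx M i k / (v *m cokermx M) 0 k); split=> [|l lt lj].
  rewrite -[RHS](divff vk) mxE mulr_suml; apply: eq_bigr => i _.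
  by rewrite !mxE; ring.
have := congr1 (fun W : 'M[rat]_(n, d) => W l k) (mulmx_coker M); rewrite !mxE => E.
rewrite -[RHS](mul0r ((v *m cokermx M) 0 k)^-1) -[in RHS]E mulr_suml.
by apply: eq_bigr => i _; rewrite !mxE lt lj /=; ring.
Qed.

Lemma mnm_pigeonhole u (P : pred 'I_n) b :
  (n * b < \sum_(l | P l) u l)%N -> exists2 l, P l & (b <= u l)%N.
Proof.
move=> h; apply/exists_inP; apply: contraLR h; rewrite negb_exists_in => /forall_inP h.
rewrite -leqNgt; apply: (@leq_trans (\sum_(l < n | P l) b)).
  by apply: leq_sum => l /h; rewrite -ltnNge => /ltnW.
rewrite sum_nat_const leq_mul2r; apply/orP; right.
by rewrite -[X in (_ <= X)%N]card_ord; exact: max_card.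
Qed.

(** An integer relation between columns, added or subtracted, decreases [u] in the
   monomial order: [u + z] and [u - z] lie on opposite sides of [u]. *)
Lemma relation_descent (z : 'I_n -> int) u :
  (exists j, z j != 0) -> (forall l, (`|z l| <= u l)%N) ->
  (forall i, \sum_l A i l * z l = 0) ->
  exists2 u', (u' < u)%O & weight u' = weight u.
Proof.
move=> [j zj] zu zA.
pose u1 : multinom n := Multinom [tuple absz ((u l)%:Z - z l) | l < n].
pose u2 : multinom n := Multinom [tuple absz ((u l)%:Z + z l) | l < n].
have u1E l : (u1 l)%:Z = (u l)%:Z - z l.
  by rewrite multinomE tnth_mktuple gez0_abs //; have := zu l; lia.
have u2E l : (u2 l)%:Z = (u l)%:Z + z l.
  by rewrite multinomE tnth_mktuple gez0_abs //; have := zu l; lia.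
have w1 : weight u1 = weight u.
  apply/colP => i; rewrite !mxE; under eq_bigr do rewrite mxE u1E mulrBr.
  by rewrite sumrB zA subr0; apply: eq_bigr => l _; rewrite mxE.
have w2 : weight u2 = weight u.
  apply/colP => i; rewrite !mxE; under eq_bigr do rewrite mxE u2E mulrDr.
  by rewrite big_split /= zA addr0; apply: eq_bigr => l _; rewrite mxE.
have [lt|] := boolP (u1 < u)%O; first by exists u1.
rewrite -leNgt le_eqVlt => /orP[/eqP E|lt].
  by have := u1E j; rewrite -E => /eqP; rewrite -subr_eq0 opprB addrC subrK (negPf zj).
exists u2 => //; rewrite -(ltmc_add2r u1).
rewrite (_ : mnm_add u1 u2 = mnm_add u u) ?ltmc_add2l //.
apply/mnmP => l; rewrite !mnmDE; have := u1E l; have := u2E l; lia.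
Qed.

(** [L al m] stands for the coefficient of [x^m] in the value at [s^al] of a linear
   form over [C(x)]. The relations preserve [u + m]: trading a factor [d_j] of the
   operator for a factor [d_l] trades a factor [x_l] of the coefficient for [x_j].
   The induction is on [u + m] in the monomial order, and for fixed [u + m] a
   descending one on a set [t] of large coordinates of [u]. *)
Lemma coefficients_vanish : exists k0, forall (C : numFieldType)
    (L : 'cV[int]_d -> multinom n -> C),
  (forall u m, (mdeg u <= k0)%N -> L (weight u) m = 0) ->
  (forall w m i, (mdeg w <= k0)%N ->
    \sum_l (A i l)%:~R * (if m l == 0%N then 0
      else L (weight w + col l A) (mnm_sub m (mnm1 l))) = 0) ->
  forall u m, mdeg u = k0.+1 -> L (weight u) m = 0.
Proof.
have /choice[z hz] (p : {set 'I_n} * 'I_n) : exists z : 'I_n -> int,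
    dependent p.1 p.2 -> [/\ z p.2 != 0, forall l, l \notin p.1 -> z l = 0 &
      forall i, \sum_l A i l * z l = 0].
  have [[z h]|h] := pselect (dependent p.1 p.2); first by exists z.
  by exists (fun=> 0).
pose Z := \max_p \max_l `|z p l|%N.
have zZ p l : (`|z p l| <= Z)%N.
  by apply: leq_trans (leq_bigmax p); exact: (leq_bigmax l).
(* [B #|t|] is the bound above which the coordinates in [t] count as large: above
   [Z] so that relations can be subtracted, and decreasing fast enough for [t] to
   give up degree until another coordinate becomes large. *)
pose B k := (Z.+1 * n.+2 ^ (n.+1 - k))%N.
have BZ k : (Z < B k)%N by rewrite /B leq_pmulr // expn_gt0.
have BS k : (k <= n)%N -> (B k.+1 + (n * B k.+1).+1 <= B k)%N.
  move=> kn; rewrite {3}/B subSn // expnS mulnCA -[(_ * _ ^ _)%N]/(B k.+1).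
  have := BZ k.+1; nia.
exists (n * B 1)%N => C L H1 H2 u m uk; move: {2}(mnm_add u m) (erefl (mnm_add u m)) => q.
have : (mdeg u <= (n * B 1).+1)%N by rewrite uk.
elim/(well_founded_ind (@ltom_wf n)): q u m {uk} => q IH u m uk uq.
move: uk; rewrite leq_eqVlt ltnS => /orP[/eqP uk|]; last exact: H1.
pose vanishes t b := forall u m, mnm_add u m = q -> mdeg u = (n * B 1).+1 ->
  (forall j, j \in t -> (b <= u j)%N) -> L (weight u) m = 0.
have step t : (0 < #|t|)%N -> (forall l, l \notin t -> vanishes (l |: t) (B #|t|.+1)) ->
    vanishes t (B #|t|).
  move=> /card_gt0P[j jt] IHt {u m uk uq}u m uq uk ut.
  have [dep|[c [cj cl]]] := dependent_or_dual jt.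
    have [zj zt zA] := hz (t, j) dep.
    have zu l : (`|z (t, j) l| <= u l)%N.
      have [lt|/zt ->] := boolP (l \in t); last by rewrite absz0.
      exact: leq_trans (zZ _ _) (leq_trans (ltnW (BZ _)) (ut l lt)).
    have [u' u'u <-] := relation_descent (ex_intro _ j zj) zu zA.
    apply: (IH (mnm_add u' m)) => //; first by rewrite -uq ltmc_add2l.
    by rewrite -uk; apply: lemc_mdeg; exact: ltW.
  have tn : (#|t| <= n)%N by rewrite -[X in (_ <= X)%N]card_ord; exact: max_card.
  set b := B #|t|.+1.
  (* [s] bounds the number of units still to be moved out of [t]. *)
  suff transfer s : forall u m, mnm_add u m = q -> mdeg u = (n * B 1).+1 ->
      (n * b < \sum_(l | l \notin t) u l + s)%N ->
      (forall l, l \in t -> (b + s <= u l)%N) -> L (weight u) m = 0.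
    apply: (transfer (n * b).+1) => // [|l lt]; first by rewrite addnS ltnS leq_addl.
    by apply: leq_trans (BS _ tn) (ut l lt).
  elim: s {u m uq uk ut} => [|s IHs] u m uq uk us ut.
    rewrite addn0 in us; have [l lt bl] := mnm_pigeonhole us.
    apply: (IHt l lt) => // j'; rewrite !inE => /orP[/eqP -> //|/ut].
    by rewrite addn0.
  have uj : u j != 0%N by rewrite -lt0n; apply: leq_trans (ut j jt); rewrite addnS.
  pose w := mnm_sub u (mnm1 j).
  have wE : mnm_add w (mnm1 j) = u by rewrite submK // lep1mP.
  have wk : mdeg w = (n * B 1)%N by have := uk; rewrite -wE mdegD mdeg1 addn1 => -[].
  pose F l := if mnm_add m (mnm1 j) l == 0%N then 0
    else L (weight w + col l A) (mnm_sub (mnm_add m (mnm1 j)) (mnm1 l)).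
  have H i : \sum_l (A i l)%:~R * F l = 0 by apply: H2; rewrite wk.
  have : \sum_i ratr (c i) * (\sum_l (A i l)%:~R * F l) = 0.
    by rewrite big1 // => i _; rewrite H mulr0.
  under eq_bigr do rewrite mulr_sumr.
  rewrite exchange_big /= (bigD1 j) //= [X in _ + X]big1 => [|l lj].
    have Fj : F j = L (weight u) m.
      by rewrite /F mnmDE mnm1E eqxx addn1 /= addmK -wE weightD weight1.
    rewrite addr0 Fj; under eq_bigr do rewrite mulrA.
    rewrite -mulr_suml (_ : \sum_i _ = ratr (\sum_i c i * (A i j)%:~R)).
      by rewrite cj rmorph1 mul1r.
    by rewrite rmorph_sum; apply: eq_bigr => i _; rewrite rmorphM /= ratr_int.
  have [lt|lt] := boolP (l \in t).
    under eq_bigr do rewrite mulrA.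
    rewrite -mulr_suml (_ : \sum_i _ = ratr (\sum_i c i * (A i l)%:~R)).
      by rewrite cl // rmorph0 mul0r.
    by rewrite rmorph_sum; apply: eq_bigr => i _; rewrite rmorphM /= ratr_int.
  suff -> : F l = 0 by rewrite big1 // => i _; rewrite !mulr0.
  rewrite /F; case: ifPn => // ml; rewrite -weight1 -weightD; apply: IHs.
  - rewrite -uq -[in RHS]wE -addmA [mnm_add (mnm1 l) _]addmC submK ?lep1mP //.
    by rewrite -addmA [mnm_add (mnm1 j) m]addmC.
  - by rewrite mdegD mdeg1 wk addn1.
  - apply: leq_trans us _; rewrite (bigD1 l) // [in X in (_ <= X)%N](bigD1 l) //=.
    rewrite mnmDE mnm1E eqxx addn1 -addSnnS leq_add2r -addSn.
    have wl l' : l' \notin t -> w l' = u l'.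
      move=> l't; rewrite /w mnmBE mnm1E; case: eqP => [E|]; rewrite ?subn0 //.
      by move: l't; rewrite -E jt.
    rewrite wl // leq_add2l; apply: leq_sum => l' /andP[l't l'l].
    by rewrite mnmDE wl // leq_addr.
  move=> l' l't; rewrite mnmDE mnmBE mnm1E; have := ut l' l't.
  by case: eqP => _; case: (_ l'); lia.
have main s t : (#|t| + s = n)%N -> (0 < #|t|)%N -> vanishes t (B #|t|).
  elim: s t => [|s IHs] t tn t0; apply: step => // l lt.
    have : (#|l |: t| <= n)%N by rewrite -[X in (_ <= X)%N]card_ord; exact: max_card.
    by rewrite cardsU1 lt add1n -[#|t|]addn0 tn ltnn.
  have cl : #|l |: t| = #|t|.+1 by rewrite cardsU1 lt.
  by rewrite -cl; apply: IHs; rewrite cl // addSnnS.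
have [j _ uj] : exists2 j, xpredT j & (B 1 <= u j)%N.
  by apply: mnm_pigeonhole; rewrite -mdegE uk.
have n0 : (0 < n)%N := leq_ltn_trans (leq0n j) (ltn_ord j).
apply: (main n.-1 [set j]); rewrite ?cards1 //; first by rewrite add1n prednK.
by move=> l; rewrite inE => /eqP ->.
Qed.

End Vanishing.

Section Generic.
Variables (d n : nat) (C : numFieldType) (A : 'M[int]_(d, n)).
Local Notation K := {fraction (mpoly n C)}.
Variable b : 'I_d -> K.
Local Notation T := ('cV[int]_d -> K^o).
Local Notation tofrac := (@FracField.tofrac (mpoly n C)).

Definition generic_point (j : 'I_n) : K := tofrac (mpolyX C (mnm1 j)).

Lemma mcoeff_mulXU (j : 'I_n) (p : mpoly n C) m :
  mcoeff m (mpolyX C (mnm1 j) * p) =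
  if m j == 0%N then 0 else mcoeff (mnm_sub m (mnm1 j)) p.
Proof.
rewrite mulrC; case: ifPn => mj; last first.
  by rewrite -{1}(submK (_ : lem (mnm1 j) m)) ?lep1mP // addmC mcoeffMX.
apply: memN_msupp_eq0; rewrite (perm_mem (msuppMX _ _)).
by apply: contraL mj => /mapP[m' _ ->]; rewrite mnmDE mnm1E eqxx.
Qed.

Lemma common_denominator (I : finType) (f : I -> K) :
  exists q (p : I -> mpoly n C), q != 0 /\ forall i, tofrac (p i) = tofrac q * f i.
Proof.
have /choice[pq hpq] i : exists pq : mpoly n C * mpoly n C,
    pq.2 != 0 /\ f i = tofrac pq.1 / tofrac pq.2.
  by have [p [q h]] := fracP (f i); exists (p, q).
exists (\prod_i (pq i).2), (fun i => (pq i).1 * \prod_(l | l != i) (pq l).2).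
split=> [|i]; first by apply/prodf_neq0 => i _; have [] := hpq i.
have [q0 ->] := hpq i; rewrite [\prod_l (pq l).2](bigD1 i) //= !rmorphM /=.
have qi0 : tofrac (pq i).2 != 0 by rewrite tofrac_eq0.
by rewrite [RHS]mulrC mulrA divfK.
Qed.

(** If the generators did not span, a linear form would vanish on them but not on
   some [delta]; after clearing denominators, the coefficients of its values satisfy
   the relations of [coefficients_vanish]. *)
Lemma generic_generation : exists k0, forall v, mdeg v = k0.+1 ->
  lspan (deltas_euler A generic_point b k0) (delta K (weight A v)).
Proof.
have [k0 vanish] := coefficients_vanish A; exists k0 => v vk.
pose s := reach A k0.+1; pose N := size s.
have in_s u : (mdeg u <= k0.+1)%N -> weight A u \in s by move=> uk; apply/reachP; exists u.
pose I := (bmultinom n k0.+1 + 'I_d * bmultinom n k0.+1)%type.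
pose gen (i : I) : T := match i with
  | inl u => delta K (weight A u)
  | inr iu => euler A generic_point b iu.1 (delta K (weight A iu.2)) end.
have gen_out i al : al \notin s -> gen i al = 0.
  have out u : (mdeg u <= k0.+1)%N -> al \notin s -> delta K (weight A u) al = 0.
    move=> /in_s us als; rewrite /delta; case: eqP => // E.
    by move: als; rewrite E us.
  move=> als; case: i => [u|[i u]] /=; first by rewrite out // ltnW // bmdeg.
  have uk := bmdeg u.
  have scaleTE c f : (c *: f : T) al = c * f al by [].
  rewrite euler_delta [LHS](_ : _ = ((weight A u i 0)%:~R - b i) * delta K (weight A u) al +
    (\sum_j ((A i j)%:~R * generic_point j) *: delta K (weight A u + col j A)) al) //.
  rewrite out ?(ltnW uk) // mulr0 add0r fct_sumE big1 // => j _.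
  by rewrite scaleTE -weight1 -weightD out ?mulr0 // mdegD mdeg1 addn1.
pose G : 'M[K]_(#|{: I}|, N) := \matrix_(a, p) gen (enum_val a) (nth 0 s p).
pose r : 'rV[K]_N := \row_p delta K (weight A v) (nth 0 s p).
(* When [r] is not in the row space, a column of the cokernel of [G] is a linear form
   separating it from the generators. *)
have [/submxP[y yE]|] := boolP (r <= G)%MS.
  rewrite (_ : delta K _ = \sum_a y 0 a *: gen (enum_val a)).
    apply: lspan_sum => a _; apply: lspanZ; apply: lspan_gen.
    case: (enum_val a) => [u|[i u]] /=; [left|right].
      by exists u; rewrite -ltnS bmdeg.
    exists i, (delta K (weight A u)); split => //.
    by exists u; rewrite -ltnS bmdeg.
  apply/funext => al; rewrite fct_sumE.
  have [als|als] := boolP (al \in s); last first.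
    rewrite /delta big1 => [|a _]; last first.
      by rewrite -[LHS]/(y 0 a * gen (enum_val a) al) gen_out // mulr0.
    case: eqP als => // ->; by rewrite in_s // vk.
  have pN : (index al s < N)%N by rewrite index_mem.
  have := congr1 (fun w : 'rV[K]_N => w 0 (Ordinal pN)) yE; rewrite !mxE nth_index //.
  move=> ->; apply: eq_bigr => a _; by rewrite !mxE nth_index.
rewrite submxE => /eqP rG.
have [k rk] : exists k, (r *m cokermx G) 0 k != 0.
  apply/existsP; apply: contra_notT rG; rewrite negb_exists => /forallP rG.
  by apply/rowP => k; rewrite [RHS]mxE; apply/eqP; rewrite -[_ == _]negbK.
pose lam (g : T) : K := \sum_(p < N) g (nth 0 s p) * cokermx G p k.
have lamG i : lam (gen i) = 0.
  have := congr1 (fun W : 'M[K]_(_, _) => W (enum_rank i) k) (mulmx_coker G).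
  by rewrite mxE [RHS]mxE => <-; apply: eq_bigr => p _; rewrite [G _ _]mxE enum_rankK.
have lamD f g : lam (f + g) = lam f + lam g.
  by rewrite -big_split; apply: eq_bigr => p _ /=; rewrite -mulrDl.
have lamZ c f : lam (c *: f) = c * lam f.
  by rewrite mulr_sumr; apply: eq_bigr => p _; rewrite mulrA.
have lam0 : lam 0 = 0 by rewrite /lam big1 // => p _; rewrite mul0r.
have lamsum (F : 'I_n -> T) : lam (\sum_j F j) = \sum_j lam (F j).
  exact: (big_morph lam lamD lam0).
have [q [P [q0 PE]]] := common_denominator (fun p : 'I_N => cokermx G p k).
pose Lp al : mpoly n C := \sum_(p < N) (nth 0 s p == al)%:R * P p.
have LpE al : tofrac (Lp al) = tofrac q * lam (delta K al).
  rewrite rmorph_sum mulr_sumr; apply: eq_bigr => p _ /=.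
  rewrite rmorphM /= PE /delta; case: eqP => _.
    by rewrite rmorph1 !mul1r.
  by rewrite rmorph0 !mul0r mulr0.
have Lp0 al : lam (delta K al) = 0 -> Lp al = 0.
  by move=> l0; apply/eqP; rewrite -tofrac_eq0 LpE l0 mulr0.
have low u : (mdeg u <= k0)%N -> lam (delta K (weight A u)) = 0.
  by move=> uk; have uk' : (mdeg u < k0.+1)%N by []; exact: (lamG (inl (BMultinom uk'))).
pose L al m := mcoeff m (Lp al).
suff LpV : Lp (weight A v) = 0.
  case/negP: rk; apply/eqP.
  transitivity (lam (delta K (weight A v))).
    by rewrite mxE; apply: eq_bigr => p _; rewrite mxE.
  have /eqP := LpE (weight A v); rewrite LpV rmorph0 eq_sym mulf_eq0 tofrac_eq0.
  by rewrite (negPf q0) => /eqP.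
apply/mpolyP => m; rewrite mcoeff0; apply: (vanish C L _ _ v m vk).
  by move=> u m' uk; rewrite /L Lp0 ?low // mcoeff0.
move=> w m' i wk.
have rel : \sum_j (mpolyX C (mnm1 j) * Lp (weight A w + col j A)) *~ A i j = 0.
  apply/eqP; rewrite -tofrac_eq0 rmorph_sum /=; apply/eqP.
  have wk' : (mdeg w < k0.+1)%N by [].
  have := lamG (inr (i, BMultinom wk')); rewrite /= euler_delta lamD lamZ low // mulr0 add0r.
  rewrite lamsum => /(congr1 (fun z => tofrac q * z)).
  rewrite mulr0 mulr_sumr => E; rewrite -[RHS]E.
  apply: eq_bigr => j _; rewrite lamZ rmorphMz rmorphM /= LpE -mulrzl /generic_point.
  by ring.
have := congr1 (mcoeff m') rel; rewrite mcoeff0 raddf_sum /= => E; rewrite -[RHS]E.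
by apply: eq_bigr => j _; rewrite raddfMz /= mcoeff_mulXU mulrzl.
Qed.

End Generic.

Local Open Scope classical_set_scope.

(** * From the hypergeometric ideal to the Euler operators *)

(** A supremum of dimensions is infinite or attained, and a free family of maximal
   size spans. *)
Lemma quotient_dim_spans (R : realType) (K : fieldType) (V : lmodType K) (W : set V) :
  (forall c v, W v -> W (c *: v)) ->
  quotient_dim R W = +oo%E \/
  exists r (g : 'I_r -> V), (r%:R%:E <= quotient_dim R W)%E /\
    forall v, exists kappa : 'I_r -> K, W (v - \sum_i kappa i *: g i).
Proof.
move=> WZ; pose S := [set k : nat | exists v : 'I_k -> V,
  forall c : 'I_k -> K, W (\sum_(i < k) c i *: v i) -> forall i, c i = 0].
have ub k : S k -> (k%:R%:E <= quotient_dim R W)%E.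
  by move=> Sk; apply: ereal_sup_ubound; exists k.
have [unbounded|] := pselect (forall N, exists2 k, S k & (N <= k)%N).
  left; apply/eqyP => t t0; have [k Sk tk] := unbounded (Num.bound t).
  apply: le_trans (ub k Sk); rewrite lee_fin; apply: ltW.
  by apply: lt_le_trans (archi_boundP (ltW t0)) _; rewrite ler_nat.
move=> /existsNP[N SN]; right.
have S0 : exists k, `[< S k >].
  exists 0%N; apply/asboolP; exists (fun=> 0) => c _ [[]] //.
have Sbound k : `[< S k >] -> (k <= N)%N.
  move=> /asboolP Sk; rewrite leqNgt; apply/negP => Nk; apply: SN.
  by exists k => //; exact: ltnW.
case: (ex_maxnP S0 Sbound) => r /asboolP Sr rmax.
have [g gind] := Sr; exists r, g; split=> [|v]; first exact: ub.
have : ~ S r.+1 by move=> /asboolP /rmax; rewrite ltnn.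
move=> /forallNP/(_ (fun i => if unlift ord_max i is Some j then g j else v)).
move=> /existsNP[c] /not_implyP[Wc c0].
have E : \sum_i c i *: (if unlift ord_max i is Some j then g j else v) =
    \sum_(i < r) c (lift ord_max i) *: g i + c ord_max *: v.
  rewrite big_ord_recr /= unlift_none; congr (_ + _); apply: eq_bigr => i _.
  have -> : widen_ord (leqnSn r) i = lift ord_max i by apply: ord_inj; rewrite lift_max.
  by rewrite liftK.
have cm : c ord_max != 0.
  apply/eqP => cm; apply: c0 => i.
  case: (unliftP ord_max i) => [j|] ->; last exact: cm.
  by apply: (gind (fun j => c (lift ord_max j))); move: Wc; rewrite E cm scale0r addr0.
exists (fun i => - (c ord_max)^-1 * c (lift ord_max i)).
have := WZ (c ord_max)^-1 _ Wc; rewrite E scalerDr scalerA mulVf // scale1r addrC.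
congr (W _); congr (_ + _); rewrite scaler_sumr -sumrN; apply: eq_bigr => i _.
by rewrite scalerA mulNr scaleNr opprK.
Qed.

Section DiffopMonomials.
Variables (n : nat) (L : comNzRingType) (D : derivations n L).

Lemma dmonM u v : dmon D u * dmon D v = dmon D (mnm_add u v).
Proof.
rewrite [LHS]dmulXl; elim/mnm_indU: u => [|u i IH]; first by rewrite pdmulm0 add0m.
by rewrite pdmulmS IH pdmulX -addmA [mnm_add v _]addmC addmA.
Qed.

Lemma diffop_scaleAl c (P Q : diffop D) :
  (c *: P : diffop D) * Q = c *: (P * Q : diffop D).
Proof. exact: dmulZl. Qed.

Lemma prod_dpartial (v : 'I_n -> nat) :
  \prod_(j < n) dpartial D j ^+ v j = dmon D (Multinom [tuple v j | j < n]).
Proof.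
rewrite [X in dmon D X]multinomUE_id.
rewrite (big_morph (dmon D) (fun u w => esym (dmonM u w)) (erefl : dmon D mnm0 = 1)).
apply: eq_bigr => j _; rewrite multinomE tnth_mktuple.
elim: (v j) => [|k IH]; first by rewrite expr0 mulm0n.
by rewrite exprS IH mulmS -dmonM.
Qed.

Lemma dmon_const u c : (forall i, D i c = 0) -> dmon D u * dcoef D c = c *: dmon D u.
Proof.
move=> Dc; rewrite [LHS]dmulXl; elim/mnm_indU: u => [|u i IH].
  by rewrite pdmulm0 dcoefZ.
by rewrite pdmulmS IH pdmulZ Dc scale0r add0r pdmulX.
Qed.

(** Leibniz rule for a coordinate function [x] of index [j]. *)
Lemma dmon_theta u j x : (forall i, D i x = (i == j)%:R) ->
  dmon D u * (dcoef D x * dpartial D j) =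
  x *: dmon D (mnm_add u (mnm1 j)) + (u j)%:R *: dmon D u.
Proof.
move=> Dx; rewrite [LHS]dmulXl dcoefE; elim/mnm_indU: u => [|u i IH].
  by rewrite pdmulm0 add0m mnm0E scale0r addr0.
rewrite pdmulmS IH pdmulD !pdmulZ Dx !pdmulX.
have -> : D i (u j)%:R = 0 by rewrite raddfMn /= der1 mul0rn.
rewrite scale0r add0r -[X in _ + X + _ = _]/(_) -!addmA [mnm_add (mnm1 j) _]addmC.
rewrite addrAC mnmDE mnm1E natrD scalerDl addrC; congr (_ + _); rewrite addrC.
by have [->|] := eqVneq i j; rewrite ?scale0r.
Qed.

End DiffopMonomials.

Section RankBound.
Variables (d n : nat) (C : numFieldType) (A : 'M[int]_(d, n)) (beta : 'cV[C]_d).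
Local Notation K := {fraction (mpoly n C)}.
Local Notation D := (mpoly_derivations n C).
Local Notation FD := (frac_derivations (mpoly_derivations n C)).
Local Notation T := ('cV[int]_d -> K^o).
Local Notation x := (@generic_point n C).
Local Notation tofrac := (@FracField.tofrac (mpoly n C)).

Definition beta_frac (i : 'I_d) : K := tofrac (mpolyC n (beta i 0)).
Local Notation b := beta_frac.

(** The map [R -> C(x)[Z^d]], [d^u |-> s^(A u)]; its kernel contains the toric
   operators, and right multiplication by an Euler operator becomes [euler]. *)
Definition symbol (P : ratdiffop n C) : T :=
  linext (fun u => delta K (weight A u)) P.

Lemma symbolD (P Q : ratdiffop n C) : symbol (P + Q) = symbol P + symbol Q.
Proof. exact: linearD. Qed.

Lemma symbolB (P Q : ratdiffop n C) : symbol (P - Q) = symbol P - symbol Q.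
Proof. exact: linearB. Qed.

Lemma symbolZ c (P : ratdiffop n C) : symbol (c *: P) = c *: symbol P.
Proof. exact: linearZ. Qed.

Lemma symbol_sum (I : Type) (r : seq I) (p : pred I) (F : I -> ratdiffop n C) :
  symbol (\sum_(i <- r | p i) F i) = \sum_(i <- r | p i) symbol (F i).
Proof. exact: linear_sum. Qed.

Lemma symbol_dmon u : symbol (dmon FD u) = delta K (weight A u).
Proof. exact: linextX. Qed.

Lemma symbol_deltas P : exists k, lspan (deltas A k) (symbol P).
Proof.
exists (msize (P : mpoly n K)); rewrite /symbol /linext big_seq_cond.
apply: lspan_sum => u; rewrite andbT => uP; apply: lspanZ; apply: lspan_gen.
by exists u; split=> //; apply: ltnW; exact: msize_mdeg_lt.
Qed.

Lemma weyl_ratB (P Q : weyl n C) : weyl_rat (P - Q) = weyl_rat P - weyl_rat Q.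
Proof. exact: raddfB. Qed.

Lemma weyl_rat_sum (I : Type) (r : seq I) (p : pred I) (F : I -> weyl n C) :
  weyl_rat (\sum_(i <- r | p i) F i) = \sum_(i <- r | p i) weyl_rat (F i).
Proof. exact: raddf_sum. Qed.

Lemma weyl_ratMz (P : weyl n C) (z : int) : weyl_rat (P *~ z) = weyl_rat P *~ z.
Proof. exact: raddfMz. Qed.

Lemma weyl_rat_dmon u : weyl_rat (dmon D u) = dmon FD u.
Proof. exact: map_diffop_mon. Qed.

Lemma weyl_rat_coef f : weyl_rat (dcoef D f) = dcoef FD (tofrac f).
Proof. by rewrite !dcoefZ /weyl_rat map_diffopZ map_diffop_mon. Qed.

Lemma symbol_toric (P : ratdiffop n C) (u v : 'cV[nat]_n) :
  A *m map_mx Posz u = A *m map_mx Posz v ->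
  symbol (P * weyl_rat (toric_op C u v)) = 0.
Proof.
move=> Auv; rewrite /toric_op !prod_dpartial weyl_ratB !weyl_rat_dmon mulrBr symbolB.
set u' := Multinom _; set v' := Multinom _.
have uv : weight A u' = weight A v'.
  rewrite /weight (_ : \col_j _ = map_mx Posz u) ?Auv.
    by congr mulmx; apply/colP => j; rewrite !mxE multinomE tnth_mktuple.
  by apply/colP => j; rewrite !mxE multinomE tnth_mktuple.
apply/eqP; rewrite subr_eq0; apply/eqP; elim/diffop_ind: P => [|P Q hP hQ|c w].
- by rewrite !mul0r.
- by rewrite !mulrDl !symbolD hP hQ.
by rewrite !diffop_scaleAl !dmonM !symbolZ !symbol_dmon !weightD uv.
Qed.

Lemma fracder_generic i j : FD i (x j) = (i == j)%:R.
Proof.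
rewrite [LHS]fracder_tofrac /= mderivX mnm1E eq_sym; case: eqP => [->|_].
  rewrite (_ : mnm_sub _ _ = mnm0) ?mpolyX0 ?scale1r ?tofrac1 //.
  by apply/mnmP => l; rewrite mnmBE mnm0E subnn.
by rewrite scale0r tofrac0.
Qed.

Lemma symbol_euler (P : ratdiffop n C) i : symbol (P * weyl_rat (euler_op A beta i)) =
  euler A x b i (symbol P).
Proof.
elim/diffop_ind: P => [|P Q hP hQ|c u].
- by rewrite mul0r /symbol !linear0.
- by rewrite mulrDl !symbolD hP hQ linearD.
rewrite diffop_scaleAl !symbolZ linearZ; congr (_ *: _).
rewrite symbol_dmon [RHS]euler_delta /euler_op weyl_ratB weyl_rat_sum mulrBr symbolB.
rewrite weyl_rat_coef dmon_const => [|k]; last first.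
  by rewrite [LHS]fracder_tofrac /= mderivC tofrac0.
rewrite symbolZ symbol_dmon mulr_sumr symbol_sum.
transitivity (\sum_j (((A i j)%:~R * x j) *: delta K (weight A u + col j A)
    + ((A i j)%:~R * (u j)%:R) *: delta K (weight A u))
    - b i *: delta K (weight A u)).
  congr (_ - _); apply: eq_bigr => j _.
  rewrite weyl_ratMz weyl_ratM weyl_rat_coef weyl_rat_dmon mulrzAr.
  rewrite dmon_theta; last by move=> k; exact: fracder_generic.
  rewrite -scaler_int symbolZ symbolD !symbolZ !symbol_dmon scalerDr !scalerA.
  by rewrite weightD weight1.
rewrite big_split /= -scaler_suml [X in X - _]addrC addrAC -scalerBl.
congr ((_ - _) *: _ + _); rewrite mxE rmorph_sum; apply: eq_bigr => j _.
by rewrite mxE rmorphM.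
Qed.

Lemma symbol_ideal P : left_ideal (@weyl_rat n C @` gkz_ideal A beta) P ->
  exists Q : 'I_d -> ratdiffop n C, symbol P = \sum_i euler A x b i (symbol (Q i)).
Proof.
pose im P := exists Q : 'I_d -> ratdiffop n C,
  symbol P = \sum_i euler A x b i (symbol (Q i)).
have im0 : im 0.
  by exists (fun=> 0); rewrite /symbol big1 ?linear0 // => i _; rewrite !linear0.
have imD P1 P2 : im P1 -> im P2 -> im (P1 + P2).
  move=> [Q1 h1] [Q2 h2]; exists (fun i => Q1 i + Q2 i).
  by rewrite symbolD h1 h2 -big_split; apply: eq_bigr => i _; rewrite symbolD linearD.
move=> [m [q [s [hs ->]]]]; apply: (big_ind im) => // k _.
have [_ [m' [q' [s' [hs' ->]]]] <-] := hs k.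
rewrite weyl_rat_sum mulr_sumr; apply: (big_ind im) => // l _.
rewrite weyl_ratM mulrA; have [[i ->]|[u [v [Auv ->]]]] := hs' l.
  exists (fun i' => if i' == i then q k * weyl_rat (q' l) else 0).
  rewrite symbol_euler (bigD1 i) //= eqxx big1 ?addr0 // => i' /negPf ->.
  by rewrite /symbol !linear0.
exists (fun=> 0); rewrite symbol_toric // big1 // => i _.
by rewrite /symbol !linear0.
Qed.

Lemma holonomic_rank_growth (R : realType) :
  holonomic_rank R (gkz_ideal A beta) = +oo%E \/
  exists r q c e k0 : nat, (r%:R%:E <= holonomic_rank R (gkz_ideal A beta))%E /\
    forall k, (size (reach A (k0 + (k + e))) <=
      r * 'C(d + (k + c), d) + q * ('C(d + (k + e), d) - 'C(d + k, d)))%N.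
Proof.
rewrite /holonomic_rank; set W := left_ideal _.
have WZ c P : W P -> W (c *: P).
  move=> [m [q [s [hs ->]]]]; exists m, (fun k => c *: q k), s; split => //.
  by rewrite scaler_sumr; apply: eq_bigr => k _; rewrite diffop_scaleAl.
have [->|[r [g [rle gspan]]]] := quotient_dim_spans R WZ; [by left|right].
have [k0 Hgen] := generic_generation A b.
have [|q [c [e H]]] := card_reach_le (g := fun i => symbol (g i)) Hgen.
  move=> u; have [kappa Wu] := gspan (dmon FD u).
  have [Q hQ] := symbol_ideal Wu.
  exists kappa, (fun i => symbol (Q i)); split=> [i|]; first exact: symbol_deltas.
  rewrite -hQ -symbol_dmon symbolB symbol_sum addrC.
  by under [X in _ - X]eq_bigr do rewrite symbolZ; rewrite subrK.
by exists r, q, c, e, k0.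
Qed.

End RankBound.

(** * Volume and lattice points *)

Section Covering.
Variables (R : realType) (d n : nat) (A : 'M[int]_(d, n)).

Lemma hull_coordinates (p : 'cV[R]_d) :
  convex_hull ([set 0] `|` range (fun j : 'I_n => map_mx intr (col j A))) p ->
  exists lam : 'I_n -> R, [/\ forall j, 0 <= lam j, \sum_j lam j <= 1 &
    forall i, p i 0 = \sum_j (A i j)%:~R * lam j].
Proof.
pose Y : set 'cV[R]_d := [set p | exists lam : 'I_n -> R, [/\ forall j, 0 <= lam j,
  \sum_j lam j <= 1 & forall i, p i 0 = \sum_j (A i j)%:~R * lam j]].
move=> hp; have : Y p; last by [].
move: p hp; apply: smallest_sub => [|p].
  move=> x y t; rewrite !inE => -[l [l0 l1 lx]] [l' [l'0 l'1 l'y]].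
  have t0 : 0 <= t%:num by [].
  have t1 : 0 <= 1 - t%:num by rewrite subr_ge0.
  exists (fun j => t%:num * l j + (1 - t%:num) * l' j); split.
  - by move=> j; rewrite addr_ge0 // mulr_ge0.
  - rewrite big_split -!mulr_sumr /=; nra.
  move=> i; rewrite -[LHS]/((t%:num *: (x : 'cV[R]_d) + (1 - t%:num) *: (y : 'cV[R]_d)) i 0).
  rewrite !mxE lx l'y !mulr_sumr -big_split; apply: eq_bigr => j _ /=.
  by ring.
move=> [->|[j _ <-]].
  exists (fun=> 0); split => // [|i]; first by rewrite big1 // ler01.
  by rewrite mxE big1 // => j _; rewrite mulr0.
exists (fun l => (l == j)%:R); split => [l||i]; first exact: ler0n.
  by rewrite (bigD1 j) //= eqxx big1 ?addr0 // => l /negPf ->.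
rewrite !mxE (bigD1 j) //= eqxx mulr1 big1 ?addr0 // => l /negPf ->.
by rewrite mulr0.
Qed.

Hypothesis hA : forall b : 'cV[int]_d, exists c : 'cV[int]_n, b = A *m c.

(** Each point of [k conv(0, A)], rounded down to the lattice and translated by a
   fixed vector, is a sum of about [k] columns: round the coefficients down, express the
   bounded error by [hA], and make all coefficients nonnegative. *)
Lemma lattice_points_reachable : exists m : nat, forall (k : nat) (p : 'cV[R]_d),
  convex_hull ([set 0] `|` range (fun j : 'I_n => map_mx intr (col j A))) p ->
  (\col_i Num.floor (k%:R * p i 0)) + A *m const_mx m%:Z \in reach A (k + 2 * m * n).
Proof.
have /choice[c hc] (i : 'I_d) := hA (delta_mx i 0).
pose B := (1 + \sum_i \sum_j `|A i j|)%N.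
pose m := (B * \sum_i \sum_j `|c i j ord0|)%N.
exists m => k p /hull_coordinates[lam [lam0 lam1 pE]].
pose f : 'cV[int]_n := \col_j Num.floor (k%:R * lam j).
pose z : 'cV[int]_d := \col_i Num.floor (k%:R * p i 0).
have f0 j : 0 <= f j 0 by rewrite mxE floor_ge0 mulr_ge0.
pose rem := z - A *m f.
have remB i : `|rem i 0| <= B%:Z.
  rewrite -(ler_int R) intr_norm.
  have -> : (rem i 0)%:~R = ((z i 0)%:~R - k%:R * p i 0) +
      \sum_j (A i j)%:~R * (k%:R * lam j - (f j 0)%:~R) :> R.
    rewrite pE; under [X in _ = _ + X]eq_bigr do rewrite mulrBr.
    rewrite sumrB mulr_sumr; under [X in _ = _ + (X - _)]eq_bigr do rewrite mulrCA.
    rewrite addrA subrK !mxE rmorphB rmorph_sum /=; congr (_ - _).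
    by apply: eq_bigr => j _; rewrite rmorphM.
  apply: le_trans (ler_normD _ _) _; rewrite [B%:Z%:~R]natrD lerD //.
    rewrite mxE; have := floor_itv (k%:R * p i 0).
    by rewrite rmorphD /= => /andP[h1 h2]; rewrite ler_norml; apply/andP; split; lra.
  apply: le_trans (ler_norm_sum _ _ _) _.
  rewrite natr_sum (bigD1 i) //= natr_sum ler_wpDr ?sumr_ge0 //.
  apply: ler_sum => j _; rewrite normrM -[leRHS]mulr1 ler_pM // ?normr_ge0 //.
    by rewrite -intr_norm natr_absz.
  rewrite mxE; have := floor_itv (k%:R * lam j).
  by rewrite rmorphD /= => /andP[h1 h2]; rewrite ler_norml; apply/andP; split; lra.
pose g : 'cV[int]_n := \sum_i rem i 0 *: c i.
have gm j : `|g j 0| <= m%:Z.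
  rewrite summxE; apply: le_trans (ler_norm_sum _ _ _) _.
  rewrite /m big_distrr /= -[X in _ <= X]natz natr_sum; apply: ler_sum => i _.
  rewrite mxE normrM natrM ler_pM ?normr_ge0 // ?natz //.
  by rewrite (bigD1 j) //= PoszD abszE lerDl.
have gE : A *m g = rem.
  rewrite mulmx_sumr [RHS](_ : _ = \sum_i rem i 0 *: delta_mx i 0).
    by apply: eq_bigr => i _; rewrite -scalemxAr -hc.
  by rewrite [LHS]matrix_sum_delta; apply: eq_bigr => i _; rewrite big_ord1.
pose e : 'cV[int]_n := f + g + const_mx m%:Z.
have eE j : e j 0 = f j 0 + g j 0 + m%:Z.
  by rewrite [LHS]mxE [(f + g) j 0]mxE [const_mx _ _ _]mxE.
have e0 j : 0 <= e j 0.
  by rewrite eE; have := f0 j; have := gm j; rewrite ler_norml => /andP[]; lia.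
pose u : multinom n := Multinom [tuple absz (e j 0) | j < n].
have uE j : (u j)%:Z = e j 0 by rewrite multinomE tnth_mktuple gez0_abs.
apply/reachP; exists u; split.
  have : (mdeg u)%:Z <= (k + 2 * m * n)%N%:Z; last by [].
  rewrite mdegE -[X in X <= _]natz natr_sum.
  have : \sum_j f j 0 <= k%:Z.
    rewrite -(ler_int R) rmorph_sum /=; apply: (@le_trans _ _ (\sum_j k%:R * lam j)).
      by apply: ler_sum => j _; rewrite mxE floor_le.
    by rewrite -mulr_sumr -[leRHS]mulr1 ler_wpM2l.
  have : \sum_(j < n) (u j)%:R <= \sum_(j < n) (f j 0 + (2 * m)%:Z).
    apply: ler_sum => j _; rewrite natz uE eE; have := gm j.
    by rewrite ler_norml => /andP[]; lia.
  move=> h2 h1; apply: le_trans h2 _; rewrite big_split /= PoszD lerD //.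
  by rewrite sumr_const card_ord -mulr_natr natz -PoszM.
rewrite /weight (_ : \col_j _ = e).
  by rewrite !mulmxDr gE /rem addrCA subrr addr0.
by apply/colP => j; rewrite mxE uE.
Qed.

(** Cover the hull by the cubes of edge [1/k] at the translated lattice points. *)
Lemma volume_le_reach : exists c : nat, forall k, (0 < k)%N ->
  (euclidean_volume
     (convex_hull ([set 0%R] `|` range (fun j : 'I_n => map_mx intr (col j A))))
   <= ((size (reach A (k + c)))%:R / k%:R ^+ d : R)%:E)%E.
Proof.
have [m hm] := lattice_points_reachable; exists (2 * m * n)%N => k k0.
set s := reach A _; pose N := size s.
have kR : 0 < k%:R :> R by rewrite ltr0n.
pose z q : 'cV[int]_d := nth 0 s q - A *m const_mx m%:Z.
apply: ereal_inf_lbound; exists `I_N.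
exists (fun q => \col_i ((z q i 0)%:~R / k%:R)).
exists (fun q => \col_i (((z q i 0)%:~R + 1) / k%:R)); split.
- by move=> q i; rewrite !mxE ler_pM2r ?invr_gt0 // lerDl.
- move=> p /(hm k); set al := _ + _ => ps; exists (index al s); first by rewrite /= index_mem.
  move=> i; have zE : z (index al s) i 0 = Num.floor (k%:R * p i 0).
    by rewrite /z nth_index // /al addrK mxE.
  rewrite mxE [X in _ && (_ <= X)]mxE zE.
  have := floor_itv (k%:R * p i 0); rewrite rmorphD /= => /andP[h1 h2].
  by rewrite ler_pdivrMr // ler_pdivlMr // [p i 0 * _]mulrC h1 ltW.
rewrite esum_fset //; last first.
  by move=> q _; rewrite lee_fin prodr_ge0 // => i _; rewrite !mxE -mulrBl addrAC subrr add0r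
    mul1r invr_ge0 ltW.
rewrite -fsbig_ord; under eq_bigr => q _.
  rewrite (eq_bigr (fun=> k%:R^-1)) => [|i _]; last first.
    by rewrite !mxE -mulrBl addrAC subrr add0r mul1r.
  rewrite prodr_const card_ord; over.
by rewrite sumEFin sumr_const card_ord exprVn mulr_natl.
Qed.

End Covering.

Local Close Scope classical_set_scope.

Theorem corollary1 (R : realType) (d n : nat) (A : 'M[int]_(d, n))
    (hA : forall b : 'cV[int]_d, exists c : 'cV[int]_n, b = A *m c)
    (beta : 'cV[R[i]]_d) :
  (normalized_volume R A <= holonomic_rank R (gkz_ideal A beta))%E.
Proof.
have [->|[r [q [c [e [k0 [rank_ge growth]]]]]]] := holonomic_rank_growth A beta R.
  by rewrite leey.
apply: le_trans rank_ge; rewrite /normalized_volume.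
have [m vol] := @volume_le_reach R d n A hA.
set v := euclidean_volume _ in vol *.
pose a := (m + (c + e + d))%N.
apply: (@le_limit_ratio R _ r q d a) => k kpos.
have kd : 0 < k%:R ^+ d :> R by rewrite exprn_gt0 // ltr0n.
apply: (@le_trans _ _ ((d`!)%:R%:E * ((size (reach A (k + m)))%:R / k%:R ^+ d)%:E)%E).
  by apply: lee_wpmul2l (vol k kpos); rewrite lee_fin.
rewrite -EFinM lee_fin mulrA ler_pM2r ?invr_gt0 //.
suff : (d`! * size (reach A (k + m)) <= r * (k + a) ^ d + q * ((k + a) ^ d - k ^ d))%N.
  by rewrite -(ler_nat R) natrM.
have sub : (size (reach A (k + m)) <= size (reach A (k0 + (k + m + e))))%N.
  apply: (uniq_leq_size (undup_uniq _)) => al /reachP[u [uk ->]].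
  apply/reachP; exists u; split => //; lia.
apply: (leq_trans (leq_mul (leqnn _) (leq_trans sub (growth (k + m)%N)))).
apply: leq_trans (binomial_growth _ _ _ _ _ _) _; rewrite -addnA -/a.
rewrite leq_add2l leq_mul2l leq_sub2l ?orbT //.
by apply: leq_expn2r; exact: leq_addr.
Qed.
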